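(* Let $D$ be a non-commutative division ring with uncountable center $F$ and let $N$ be an almost subnormal subgroup of $D^*$. If $N$ satisfies a non-trivial generalized power central group identity, then $N$ is contained in $F$.
   Context: $D^*$ is the multiplicative group of non-zero elements of $D$. A subgroup $H$ of a group $G$ is almost subnormal in $G$ if there are subgroups $H=H_r\le H_{r-1}\le\cdots\le H_1=G$ such that for each $1<i\le r$, $H_i$ is normal in $H_{i-1}$ or $H_i$ has finite index in $H_{i-1}$. Let $D$ be a division ring with center $F$. For a finite set $X=\{x_1,\dots,x_m\}$ of non-commuting indeterminates, $F[X,X^{-1}]$ denotes the group algebra over $F$ of the free group on $X$, and $D_F[X,X^{-1}]=D*_F F[X,X^{-1}]$ is the free product (coproduct) over $F$. A generalized group monomial over $D^*$ is an element $w\in D_F[X,X^{-1}]\setminus D$ of the form $w(x_1,\dots,x_m)=a_1x_{i_1}^{n_1}a_2x_{i_2}^{n_2}\cdots a_tx_{i_t}^{n_t}a_{t+1}$ with $a_j\in D^*$, $n_j\in\mathbb{Z}$, $x_{i_j}\in X$. For a subgroup $H$ of $D^*$, such a $w$ is a generalized power central group identity (GPCGI) of $H$ (and $H$ satisfies the GPCGI $w$) if for every $(c_1,\dots,c_m)\in H^m$ there is a positive integer $p$, depending on $(c_1,\dots,c_m)$, with $w(c_1,\dots,c_m)^p\in F$. A GPCGI $w$ is non-trivial if $w^p\in D_F[X,X^{-1}]\setminus D$ for every positive integer $p$. *)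

(* Defs.v *)
From HB Require Import structures.
From mathcomp Require Import all_boot all_order all_algebra.
From mathcomp Require Import finmap generic_quotient.
From mathcomp Require Import boolp classical_sets functions cardinality.
From mathcomp.multinomials Require Import monalg.

Set Implicit Arguments.
Unset Strict Implicit.
Unset Printing Implicit Defensive.

Import GRing.Theory.

Local Open Scope ring_scope.

Definition center (R : nzRingType) : set R :=
  [set z | forall x : R, z * x = x * z].
Arguments center R : clear implicits.

Section CenterRing.
Variable R : nzRingType.

Definition center_pred : {pred R} := fun z => `[< center R z >].

Lemma centerP (z : R) : reflect (center R z) (z \in center_pred).
Proof. exact: asboolP. Qed.

Lemma center_subring_closed : subring_closed center_pred.
Proof.
split; first by apply/centerP => x; rewrite mul1r mulr1.
- move=> a b /centerP ca /centerP cb; apply/centerP => x.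
  by rewrite mulrBl mulrBr ca cb.
- move=> a b /centerP ca /centerP cb; apply/centerP => x.
  by rewrite -mulrA cb mulrA ca mulrA.
Qed.

HB.instance Definition _ := GRing.isSubringClosed.Build R center_pred
  center_subring_closed.

Record centerType := CenterType {
  center_val :> R;
  center_valP : center_val \in center_pred }.

HB.instance Definition _ := [isSub for center_val].
HB.instance Definition _ := [Choice of centerType by <:].
HB.instance Definition _ :=
  GRing.SubChoice_isSubNzRing.Build R center_pred centerType
    center_subring_closed.

Lemma center_mulC : commutative (@GRing.mul centerType).
Proof.
move=> a b; apply: val_inj; rewrite !GRing.rmorphM /=.
exact: (centerP _ (center_valP a)).
Qed.

HB.instance Definition _ := GRing.PzRing_hasCommutativeMul.Build centerType
  center_mulC.

HB.instance Definition _ := GRing.isZmodMorphism.Build centerType R center_val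
  (rmorphB (val : centerType -> R)).
HB.instance Definition _ := GRing.isMonoidMorphism.Build centerType R center_val
  (rmorph1 (val : centerType -> R), rmorphM (val : centerType -> R)).

End CenterRing.

(* R^* as a group; when R is a division ring its elements are those of R \ {0}. *)

Section Units.
Variable R : unitRingType.

Record units := Units {
  unit_val :> R;
  unit_valP : unit_val \is a GRing.unit }.

HB.instance Definition _ := [isSub for unit_val].
HB.instance Definition _ := [Choice of units by <:].

Definition units_one : units := Units (GRing.unitr1 R).

Definition units_inv (u : units) : units :=
  @Units (unit_val u)^-1 (etrans (GRing.unitrV _) (unit_valP u)).

Lemma units_mul_subproof (u v : units) :
  unit_val u * unit_val v \is a GRing.unit.
Proof. by rewrite GRing.unitrMl ?unit_valP. Qed.

Definition units_mul (u v : units) : units := Units (units_mul_subproof u v).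

Lemma units_mulA : associative units_mul.
Proof. by move=> u v w; apply: val_inj; rewrite /= mulrA. Qed.
Lemma units_mul1 : left_id units_one units_mul.
Proof. by move=> u; apply: val_inj; rewrite /= mul1r. Qed.
Lemma units_mulr1 : right_id units_one units_mul.
Proof. by move=> u; apply: val_inj; rewrite /= mulr1. Qed.
Lemma units_mulV : left_inverse units_one units_inv units_mul.
Proof. by move=> u; apply: val_inj; rewrite /= mulVr ?unit_valP. Qed.
Lemma units_mulrV : right_inverse units_one units_inv units_mul.
Proof. by move=> u; apply: val_inj; rewrite /= mulrV ?unit_valP. Qed.

HB.instance Definition _ := isGroup.Build units
  units_mulA units_mul1 units_mulr1 units_mulV units_mulrV.

End Units.

Section AlmostSubnormal.
Local Open Scope group_scope.
Local Open Scope classical_set_scope.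
Variable G : groupType.

Definition subgroup (H : set G) : Prop :=
  [/\ H 1, (forall x y, H x -> H y -> H (x * y)) & (forall x, H x -> H x^-1)].

Definition normal_in (K H : set G) : Prop :=
  forall h k, H h -> K k -> K (k ^ h).

Definition finite_index_in (K H : set G) : Prop :=
  finite_set [set C : set G | exists2 h, H h & C = [set h * k | k in K]].

Definition almost_subnormal (N : set G) : Prop :=
  exists (r : nat) (H : nat -> set G),
    [/\ (0 < r)%N, H 1%N = setT, H r = N,
        (forall i, (1 <= i <= r)%N -> subgroup (H i)) &
        (forall i, (1 < i <= r)%N ->
           H i `<=` H i.-1 /\
           (normal_in (H i) (H i.-1) \/ finite_index_in (H i) (H i.-1)))].

End AlmostSubnormal.

(* The free group on 'I_m, as the group of reduced words: the letter          *)
(* (i, false) stands for x_i and (i, true) for x_i^-1.                        *)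

Section FreeGroup.
Variable m : nat.

Definition letter : Type := ('I_m * bool)%type.
HB.instance Definition _ := Choice.on letter.
Implicit Types (a b : letter) (s t u : seq letter).

Definition linv a : letter := (a.1, ~~ a.2).

Definition reduced s : bool := sorted (fun a b => b != linv a) s.

Record freeGroup := FreeGroup {
  fword :> seq letter;
  fwordP : reduced fword }.

HB.instance Definition _ := [isSub for fword].
HB.instance Definition _ := [Choice of freeGroup by <:].

Definition fpush a s : seq letter :=
  if s is b :: s' then (if b == linv a then s' else a :: s) else [:: a].

Lemma linvK : involutive linv.
Proof. by case=> i b; rewrite /linv /= negbK. Qed.

Lemma fpush_reduced a s : reduced s -> reduced (fpush a s).
Proof.
case: s => [//|b s] /= rs; case: ifPn => [_|ba]; last by rewrite /= ba.
by case: s rs => [//|c s] /= /andP[].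
Qed.

Lemma fcat_reduced s t : reduced t -> reduced (foldr fpush t s).
Proof. by move=> rt; elim: s => //= a s; apply: fpush_reduced. Qed.

Lemma fpushK a s : reduced s -> fpush a (fpush (linv a) s) = s.
Proof.
case: s => [_|b s] /=; first by rewrite eqxx.
rewrite linvK; case: eqP => [-> |_ _] /=; last by rewrite eqxx.
by case: s => [//|c s] /= /andP[/negbTE-> _].
Qed.

Lemma fcat_push a s t : reduced s -> reduced t ->
  foldr fpush t (fpush a s) = fpush a (foldr fpush t s).
Proof.
case: s => [//|b s] /= _ rt; case: eqP => [-> |//].
by rewrite fpushK // fcat_reduced.
Qed.

Lemma fcatA s t u : reduced t -> reduced u ->
  foldr fpush (foldr fpush u t) s = foldr fpush u (foldr fpush t s).
Proof.
move=> rt ru; elim: s => //= a s ->.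
by rewrite fcat_push // fcat_reduced.
Qed.

Lemma fcats0 s : reduced s -> foldr fpush [::] s = s.
Proof.
elim: s => //= a s IHs rs; rewrite IHs; last exact: path_sorted rs.
by case: s rs {IHs} => //= b s /andP[/negbTE-> _].
Qed.

Definition fwinv s : seq letter := rev (map linv s).

Lemma fwinv_reduced s : reduced s -> reduced (fwinv s).
Proof.
rewrite /reduced /fwinv rev_sorted sorted_map; apply: sub_sorted => a b.
apply: contra => /eqP E; apply/eqP.
by rewrite -[b]linvK -E.
Qed.

Lemma fwinvK : involutive fwinv.
Proof. by move=> s; rewrite /fwinv map_rev revK mapK //; apply: linvK. Qed.

Lemma fcatV s : foldr fpush s (fwinv s) = [::].
Proof.
elim: s => //= a s IHs; rewrite /fwinv /= rev_cons -cats1 foldr_cat /=.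
by rewrite linvK eqxx.
Qed.

Definition fg_one : freeGroup := @FreeGroup [::] isT.
Definition fg_mul (s t : freeGroup) : freeGroup :=
  FreeGroup (fcat_reduced s (fwordP t)).
Definition fg_inv (s : freeGroup) : freeGroup :=
  FreeGroup (fwinv_reduced (fwordP s)).

Lemma fg_mulA : associative fg_mul.
Proof. by move=> s t u; apply: val_inj; rewrite /= fcatA ?fwordP. Qed.
Lemma fg_mul1 : left_id fg_one fg_mul.
Proof. by move=> s; apply: val_inj. Qed.
Lemma fg_mulr1 : right_id fg_one fg_mul.
Proof. by move=> s; apply: val_inj; rewrite /= fcats0 ?fwordP. Qed.
Lemma fg_mulV : left_inverse fg_one fg_inv fg_mul.
Proof. by move=> s; apply: val_inj; rewrite /= fcatV. Qed.
Lemma fg_mulrV : right_inverse fg_one fg_inv fg_mul.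
Proof.
by move=> s; apply: val_inj; have := fcatV (fwinv s); rewrite fwinvK.
Qed.

HB.instance Definition _ := isGroup.Build freeGroup
  fg_mulA fg_mul1 fg_mulr1 fg_mulV fg_mulrV.

Definition fg_gen (i : 'I_m) : freeGroup := @FreeGroup [:: (i, false)] isT.

Section Lift.
Variables (R : pzRingType) (u : letter -> R).
Hypothesis uV : forall a, u a * u (linv a) = 1.

Definition fg_lift (s : freeGroup) : R := \prod_(a <- fword s) u a.

Lemma prod_fpush a s : \prod_(b <- fpush a s) u b = u a * \prod_(b <- s) u b.
Proof.
case: s => [|b s] /=; first by rewrite big_seq1 big_nil mulr1.
case: eqP => [-> |_]; last by rewrite big_cons.
by rewrite big_cons mulrA uV mul1r.
Qed.

Lemma fg_lift1 : fg_lift 1%g = 1.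
Proof. by rewrite /fg_lift big_nil. Qed.

Lemma fg_liftM (s t : freeGroup) : fg_lift (s * t)%g = fg_lift s * fg_lift t.
Proof.
rewrite /fg_lift /=; elim: (fword s) => [|a w IHw] /=.
  by rewrite big_nil mul1r.
by rewrite prod_fpush IHw big_cons mulrA.
Qed.

Lemma fg_lift_gen i : fg_lift (fg_gen i) = u (i, false).
Proof. by rewrite /fg_lift big_seq1. Qed.

End Lift.
End FreeGroup.

Definition gexpz (G : groupType) (g : G) (n : int) : G :=
  match n with
  | Posz k => (g ^+ k)%g
  | Negz k => (g ^- k.+1)%g
  end.

(* The group algebra F[G]: finitely supported functions G -> F with the       *)
(* convolution product; << c *g k >> is c times the group element k.  (The    *)
(* library only has this product for monoids without non-trivial units.)      *)

Definition groupAlg (F : nzRingType) (G : groupType) : Type := {malg F[G]}.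

Section GroupAlg.
Local Open Scope fset_scope.
Variables (F : nzRingType) (G : groupType).

HB.instance Definition _ := GRing.Zmodule.on (groupAlg F G).

Implicit Types (g : {malg F[G]}) (k : G).

Definition ga_mul g1 g2 : {malg F[G]} :=
  \sum_(k1 <- msupp g1) \sum_(k2 <- msupp g2)
    << g1@_k1 * g2@_k2 *g (k1 * k2)%g >>.

Definition ga_one : {malg F[G]} := << 1 *g 1%g >>.

Lemma ga_mullw (d1 d2 : {fset G}) g1 g2 :
  msupp g1 `<=` d1 -> msupp g2 `<=` d2 ->
  ga_mul g1 g2 =
  \sum_(k1 <- d1) \sum_(k2 <- d2) << g1@_k1 * g2@_k2 *g (k1 * k2)%g >>.
Proof.
move=> le_d1 le_d2; rewrite /ga_mul (big_fset_incl _ le_d1) /=.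
  apply/eq_bigr=> k1 _; apply/big_fset_incl => // k _ /mcoeff_outdom ->.
  by rewrite mulr0 monalgU0.
move=> k _ /mcoeff_outdom g1k.
by rewrite big1 => // k' _; rewrite g1k mul0r monalgU0.
Qed.

Lemma ga_mulUg c k g :
  ga_mul << c *g k >> g = \sum_(k' <- msupp g) << c * g@_k' *g (k * k')%g >>.
Proof.
rewrite (ga_mullw msuppU_le (fsubset_refl _)) big_seq_fset1.
by apply/eq_bigr => k' _; rewrite mcoeffUU.
Qed.

Lemma ga_mulgU c k g :
  ga_mul g << c *g k >> = \sum_(k' <- msupp g) << g@_k' * c *g (k' * k)%g >>.
Proof.
rewrite (ga_mullw (fsubset_refl _) msuppU_le).
by apply/eq_bigr=> k' _; rewrite big_seq_fset1 mcoeffUU.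
Qed.

Lemma ga_mulUU c1 c2 k1 k2 :
  ga_mul << c1 *g k1 >> << c2 *g k2 >> = << c1 * c2 *g (k1 * k2)%g >>.
Proof. by rewrite (ga_mullw msuppU_le msuppU_le) !big_seq_fset1 !mcoeffUU. Qed.

Lemma ga_mulEl1 g1 g2 :
  ga_mul g1 g2 = \sum_(k1 <- msupp g1) ga_mul << g1@_k1 *g k1 >> g2.
Proof. by apply/eq_bigr=> k _; rewrite ga_mulUg. Qed.

Lemma ga_mulEr1 g1 g2 :
  ga_mul g1 g2 = \sum_(k2 <- msupp g2) ga_mul g1 << g2@_k2 *g k2 >>.
Proof.
by rewrite [LHS]exchange_big; apply/eq_bigr=> k _; rewrite ga_mulgU.
Qed.

Lemma ga_mul0g : left_zero 0 ga_mul.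
Proof. by move=> g; rewrite /ga_mul msupp0 big_seq_fset0. Qed.

Lemma ga_mulg0 : right_zero 0 ga_mul.
Proof. by move=> g; rewrite ga_mulEr1 msupp0 big_seq_fset0. Qed.

Lemma ga_mul1g : left_id ga_one ga_mul.
Proof.
move=> g; rewrite ga_mulUg [RHS]monalgE.
by apply/eq_bigr=> kg _; rewrite mul1r mul1g.
Qed.

Lemma ga_mulg1 : right_id ga_one ga_mul.
Proof.
move=> g; rewrite ga_mulgU [RHS]monalgE.
by apply/eq_bigr=> k _; rewrite mulr1 mulg1.
Qed.

Lemma ga_mulgDl : left_distributive ga_mul +%R.
Proof.
move=> g1 g2 g.
rewrite [in RHS](ga_mullw (fsubsetUl _ (msupp g2)) (fsubset_refl _)).
rewrite [in RHS](ga_mullw (fsubsetUr (msupp g1) _) (fsubset_refl _)).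
rewrite (ga_mullw (msuppD_le _ _) (fsubset_refl _)).
rewrite -big_split /=; apply/eq_bigr=> k1 _.
rewrite -big_split /=; apply/eq_bigr=> k2 _.
by rewrite mcoeffD mulrDl monalgUD.
Qed.

Lemma ga_mulgDr : right_distributive ga_mul +%R.
Proof.
move=> g g1 g2.
rewrite [in RHS](ga_mullw (fsubset_refl _) (fsubsetUl _ (msupp g2))).
rewrite [in RHS](ga_mullw (fsubset_refl _) (fsubsetUr (msupp g1) _)).
rewrite (ga_mullw (fsubset_refl _) (msuppD_le _ _)).
rewrite -big_split /=; apply/eq_bigr=> k1 _.
rewrite -big_split /=; apply/eq_bigr=> k2 _.
by rewrite mcoeffD mulrDr monalgUD.
Qed.

Lemma ga_mulA : associative ga_mul.
Proof.
move=> g1 g2 g3.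
rewrite [RHS](big_morph (ga_mul^~ _) (fun _ _ => ga_mulgDl _ _ _) (ga_mul0g _)).
rewrite ga_mulEl1; apply/eq_bigr=> k1 _.
rewrite [LHS](big_morph (ga_mul _) (fun _ _ => ga_mulgDr _ _ _) (ga_mulg0 _)).
rewrite [RHS](big_morph (ga_mul^~ _) (fun _ _ => ga_mulgDl _ _ _) (ga_mul0g _)).
apply/eq_bigr=> k2 _.
rewrite [LHS](big_morph (ga_mul _) (fun _ _ => ga_mulgDr _ _ _) (ga_mulg0 _)).
by rewrite ga_mulEr1; apply/eq_bigr=> k3 _; rewrite !ga_mulUU mulrA mulgA.
Qed.

Lemma ga_oner_neq0 : ga_one != 0.
Proof.
by apply/eqP/malgP=> /(_ 1%g) /eqP; rewrite mcoeffUU mcoeff0 oner_eq0.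
Qed.

HB.instance Definition _ := GRing.Zmodule_isNzRing.Build (groupAlg F G)
  ga_mulA ga_mul1g ga_mulg1 ga_mulgDl ga_mulgDr ga_oner_neq0.

Definition ga_const (c : F) : groupAlg F G := << c *g 1%g >>.
Definition ga_elt (k : G) : groupAlg F G := << 1 *g k >>.

Lemma ga_const_is_additive : zmod_morphism ga_const.
Proof. by move=> a b; rewrite /ga_const monalgUB. Qed.
Lemma ga_const_is_monoid_morphism : monoid_morphism ga_const.
Proof.
split=> // a b; rewrite /ga_const [RHS]ga_mulUU.
by rewrite mulg1.
Qed.
HB.instance Definition _ := GRing.isZmodMorphism.Build F (groupAlg F G) ga_const
  ga_const_is_additive.
HB.instance Definition _ := GRing.isMonoidMorphism.Build F (groupAlg F G)
  ga_const ga_const_is_monoid_morphism.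

Lemma ga_elt1 : ga_elt 1%g = 1. Proof. by []. Qed.
Lemma ga_eltM k l : ga_elt (k * l)%g = ga_elt k * ga_elt l.
Proof. by rewrite [RHS]ga_mulUU mulr1. Qed.

Section Lift.
Variables (R : nzRingType) (f : {rmorphism F -> R}) (h : G -> R).
Hypotheses (h1 : h 1%g = 1) (hM : forall k l, h (k * l)%g = h k * h l).
Hypothesis fh : forall c k, f c * h k = h k * f c.

Definition ga_lift : groupAlg F G -> R := mmap f h.

Lemma ga_lift_additive : zmod_morphism ga_lift.
Proof. exact: (@mmapB G F R f h). Qed.

Lemma ga_lift_monoid_morphism : monoid_morphism ga_lift.
Proof.
split; first by rewrite /ga_lift [LHS]mmapU h1 mulr1; exact: (rmorph1 f).
move=> g1 g2; rewrite /ga_lift [_ * _ in LHS]/(ga_mul _ _) /ga_mul.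
rewrite raddf_sum [in RHS]/mmap mulr_suml; apply: eq_bigr => i _.
rewrite raddf_sum mulr_sumr; apply: eq_bigr => j _.
rewrite [LHS]mmapU hM; transitivity (f (g1@_i * g2@_j) * (h i * h j)) => //.
by rewrite rmorphM -!mulrA; congr (_ * _); rewrite !mulrA fh.
Qed.

Lemma ga_lift_const c : ga_lift (ga_const c) = f c.
Proof. by rewrite /ga_lift [LHS]mmapU h1 mulr1. Qed.
Lemma ga_lift_elt k : ga_lift (ga_elt k) = h k.
Proof.
rewrite /ga_lift [LHS]mmapU; transitivity (f 1 * h k) => //.
by rewrite rmorph1 mul1r.
Qed.

End Lift.
End GroupAlg.

(* The free product (coproduct) A *_F B of two rings over F, along            *)
(* f : F -> A and g : F -> B: ring expressions in the elements of A and B     *)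
(* modulo the congruence generated by the ring axioms, the operations of A    *)
(* and of B, and the identification of f c with g c for c in F.               *)

Section Coproduct.
Variables (F A B : pzRingType).

Inductive cexpr :=
| CInl of A
| CInr of B
| CAdd of cexpr & cexpr
| CMul of cexpr & cexpr.

HB.instance Definition _ := gen_eqMixin cexpr.
HB.instance Definition _ := gen_choiceMixin cexpr.

Variables (f : {rmorphism F -> A}) (g : {rmorphism F -> B}).

Inductive ceq : cexpr -> cexpr -> Prop :=
| ceq_refl x : ceq x x
| ceq_sym x y : ceq x y -> ceq y x
| ceq_trans x y z : ceq x y -> ceq y z -> ceq x z
| ceq_add x x' y y' : ceq x x' -> ceq y y' -> ceq (CAdd x y) (CAdd x' y')
| ceq_mul x x' y y' : ceq x x' -> ceq y y' -> ceq (CMul x y) (CMul x' y')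
| ceq_addA x y z : ceq (CAdd x (CAdd y z)) (CAdd (CAdd x y) z)
| ceq_addC x y : ceq (CAdd x y) (CAdd y x)
| ceq_add0 x : ceq (CAdd (CInl 0) x) x
| ceq_addN x : ceq (CAdd (CMul (CInl (-1)) x) x) (CInl 0)
| ceq_mulA x y z : ceq (CMul x (CMul y z)) (CMul (CMul x y) z)
| ceq_mul1 x : ceq (CMul (CInl 1) x) x
| ceq_mulr1 x : ceq (CMul x (CInl 1)) x
| ceq_mulDl x y z : ceq (CMul (CAdd x y) z) (CAdd (CMul x z) (CMul y z))
| ceq_mulDr x y z : ceq (CMul x (CAdd y z)) (CAdd (CMul x y) (CMul x z))
| ceq_inlD a a' : ceq (CInl (a + a')) (CAdd (CInl a) (CInl a'))
| ceq_inlM a a' : ceq (CInl (a * a')) (CMul (CInl a) (CInl a'))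
| ceq_inrD b b' : ceq (CInr (b + b')) (CAdd (CInr b) (CInr b'))
| ceq_inrM b b' : ceq (CInr (b * b')) (CMul (CInr b) (CInr b'))
| ceq_base c : ceq (CInl (f c)) (CInr (g c)).

Definition ceqb : rel cexpr := fun x y => `[< ceq x y >].

Lemma ceqb_refl : reflexive ceqb.
Proof. by move=> x; apply/asboolP; apply: ceq_refl. Qed.
Lemma ceqb_sym : symmetric ceqb.
Proof. by move=> x y; apply/asboolP/asboolP; apply: ceq_sym. Qed.
Lemma ceqb_trans : transitive ceqb.
Proof.
by move=> y x z /asboolP xy /asboolP yz; apply/asboolP; apply: ceq_trans xy yz.
Qed.

Canonical ceqb_equiv := EquivRel ceqb ceqb_refl ceqb_sym ceqb_trans.

Definition coprod : Type := {eq_quot ceqb}%qT.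
HB.instance Definition _ := Choice.on coprod.

Definition cclass (x : cexpr) : coprod := (\pi_({eq_quot ceqb}) x)%qT.
Definition crepr (q : coprod) : cexpr := repr (q : {eq_quot ceqb}%qT).

Lemma cclassP x y : cclass x = cclass y <-> ceq x y.
Proof.
split; first by move=> /eqmodP /asboolP.
by move=> xy; apply/eqmodP/asboolP.
Qed.

Lemma creprK q : cclass (crepr q) = q.
Proof. exact: reprK. Qed.

Lemma crepr_ceq x : ceq (crepr (cclass x)) x.
Proof. by apply/cclassP; rewrite creprK. Qed.

Definition cp_add (p q : coprod) := cclass (CAdd (crepr p) (crepr q)).
Definition cp_mul (p q : coprod) := cclass (CMul (crepr p) (crepr q)).
Definition cp_opp (p : coprod) := cclass (CMul (CInl (-1)) (crepr p)).
Definition cp_zero : coprod := cclass (CInl 0).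
Definition cp_one : coprod := cclass (CInl 1).

Lemma cp_addE x y : cp_add (cclass x) (cclass y) = cclass (CAdd x y).
Proof. by apply/cclassP/ceq_add; apply: crepr_ceq. Qed.
Lemma cp_mulE x y : cp_mul (cclass x) (cclass y) = cclass (CMul x y).
Proof. by apply/cclassP/ceq_mul; apply: crepr_ceq. Qed.
Lemma cp_oppE x : cp_opp (cclass x) = cclass (CMul (CInl (-1)) x).
Proof. by apply/cclassP/ceq_mul; [apply: ceq_refl | apply: crepr_ceq]. Qed.

Let cpE := (cp_addE, cp_mulE, cp_oppE).

Lemma cp_addA : associative cp_add.
Proof.
move=> p q r; rewrite -[p]creprK -[q]creprK -[r]creprK !cpE.
exact/cclassP/ceq_addA.
Qed.
Lemma cp_addC : commutative cp_add.
Proof.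
by move=> p q; rewrite -[p]creprK -[q]creprK !cpE; apply/cclassP/ceq_addC.
Qed.
Lemma cp_add0 : left_id cp_zero cp_add.
Proof. by move=> p; rewrite -[p]creprK !cpE; apply/cclassP/ceq_add0. Qed.
Lemma cp_addN : left_inverse cp_zero cp_opp cp_add.
Proof. by move=> p; rewrite -[p]creprK !cpE; apply/cclassP/ceq_addN. Qed.
Lemma cp_mulA : associative cp_mul.
Proof.
move=> p q r; rewrite -[p]creprK -[q]creprK -[r]creprK !cpE.
exact/cclassP/ceq_mulA.
Qed.
Lemma cp_mul1 : left_id cp_one cp_mul.
Proof. by move=> p; rewrite -[p]creprK !cpE; apply/cclassP/ceq_mul1. Qed.
Lemma cp_mulr1 : right_id cp_one cp_mul.
Proof. by move=> p; rewrite -[p]creprK !cpE; apply/cclassP/ceq_mulr1. Qed.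
Lemma cp_mulDl : left_distributive cp_mul cp_add.
Proof.
move=> p q r; rewrite -[p]creprK -[q]creprK -[r]creprK !cpE.
exact/cclassP/ceq_mulDl.
Qed.
Lemma cp_mulDr : right_distributive cp_mul cp_add.
Proof.
move=> p q r; rewrite -[p]creprK -[q]creprK -[r]creprK !cpE.
exact/cclassP/ceq_mulDr.
Qed.

HB.instance Definition _ := GRing.isPzRing.Build coprod
  cp_addA cp_addC cp_add0 cp_addN cp_mulA cp_mul1 cp_mulr1 cp_mulDl cp_mulDr.

Definition inlC (a : A) : coprod := cclass (CInl a).
Definition inrC (b : B) : coprod := cclass (CInr b).

Lemma inlC_base c : inlC (f c) = inrC (g c).
Proof. exact/cclassP/ceq_base. Qed.

Lemma inlCD a b : inlC (a + b) = inlC a + inlC b.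
Proof. by rewrite [RHS]cp_addE; apply/cclassP/ceq_inlD. Qed.
Lemma inrCD a b : inrC (a + b) = inrC a + inrC b.
Proof. by rewrite [RHS]cp_addE; apply/cclassP/ceq_inrD. Qed.

Lemma inlC_is_additive : zmod_morphism inlC.
Proof.
by move=> a b; rewrite -{2}[a](subrK b) (inlCD (a - b) b) addrK.
Qed.
Lemma inrC_is_additive : zmod_morphism inrC.
Proof.
by move=> a b; rewrite -{2}[a](subrK b) (inrCD (a - b) b) addrK.
Qed.
Lemma inlC_is_monoid_morphism : monoid_morphism inlC.
Proof.
by split=> // a b; rewrite [RHS]cp_mulE; apply/cclassP/ceq_inlM.
Qed.
Lemma inrC_is_monoid_morphism : monoid_morphism inrC.
Proof.
split; last by move=> a b; rewrite [RHS]cp_mulE; apply/cclassP/ceq_inrM.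
by rewrite -(rmorph1 g) -inlC_base rmorph1.
Qed.

HB.instance Definition _ := GRing.isZmodMorphism.Build A coprod inlC
  inlC_is_additive.
HB.instance Definition _ := GRing.isMonoidMorphism.Build A coprod inlC
  inlC_is_monoid_morphism.
HB.instance Definition _ := GRing.isZmodMorphism.Build B coprod inrC
  inrC_is_additive.
HB.instance Definition _ := GRing.isMonoidMorphism.Build B coprod inrC
  inrC_is_monoid_morphism.

Lemma coprod_ind (P : coprod -> Prop) :
    (forall a, P (inlC a)) -> (forall b, P (inrC b)) ->
    (forall p q, P p -> P q -> P (p + q)) ->
    (forall p q, P p -> P q -> P (p * q)) ->
  forall q, P q.
Proof.
move=> Pl Pr PD PM q; rewrite -[q]creprK; elim: (crepr q) => //.
- by move=> x Px y Py; rewrite -cp_addE; apply: PD.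
- by move=> x Px y Py; rewrite -cp_mulE; apply: PM.
Qed.

Section Copair.
Variables (R : pzRingType) (al : {rmorphism A -> R}) (be : {rmorphism B -> R}).
Hypothesis alf_beg : forall c, al (f c) = be (g c).

Fixpoint ceval (x : cexpr) : R :=
  match x with
  | CInl a => al a
  | CInr b => be b
  | CAdd x y => ceval x + ceval y
  | CMul x y => ceval x * ceval y
  end.

Lemma ceval_ceq x y : ceq x y -> ceval x = ceval y.
Proof.
elim=> {x y} //=.
- by move=> x y z _ -> _ ->.
- by move=> x x' y y' _ -> _ ->.
- by move=> x x' y y' _ -> _ ->.
- by move=> x y z; rewrite addrA.
- by move=> x y; rewrite addrC.
- by move=> x; rewrite rmorph0 add0r.
- by move=> x; rewrite rmorphN1 mulN1r addNr rmorph0.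
- by move=> x y z; rewrite mulrA.
- by move=> x; rewrite rmorph1 mul1r.
- by move=> x; rewrite rmorph1 mulr1.
- by move=> x y z; rewrite mulrDl.
- by move=> x y z; rewrite mulrDr.
- by move=> a a'; rewrite rmorphD.
- by move=> a a'; rewrite rmorphM.
- by move=> a a'; rewrite rmorphD.
- by move=> a a'; rewrite rmorphM.
Qed.

Definition copair (q : coprod) : R := ceval (crepr q).

Lemma copairE x : copair (cclass x) = ceval x.
Proof. exact/ceval_ceq/crepr_ceq. Qed.

Lemma copair_inl a : copair (inlC a) = al a. Proof. exact: copairE. Qed.
Lemma copair_inr b : copair (inrC b) = be b. Proof. exact: copairE. Qed.

Lemma copairD p q : copair (p + q) = copair p + copair q.
Proof. by rewrite -[p]creprK -[q]creprK [_ + _]cp_addE !copairE. Qed.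
Lemma copairM p q : copair (p * q) = copair p * copair q.
Proof. by rewrite -[p]creprK -[q]creprK [_ * _]cp_mulE !copairE. Qed.

Lemma copair_additive : zmod_morphism copair.
Proof.
by move=> p q; have := copairD (p - q) q; rewrite subrK => ->; rewrite addrK.
Qed.
Lemma copair_monoid_morphism : monoid_morphism copair.
Proof. by split; [rewrite copairE /= rmorph1 | exact: copairM]. Qed.

Lemma copair_unique (h : {rmorphism coprod -> R}) :
  (forall a, h (inlC a) = al a) -> (forall b, h (inrC b) = be b) ->
  forall q, h q = copair q.
Proof.
move=> hl hr; elim/coprod_ind => [a|b|p q hp hq|p q hp hq].
- by rewrite hl copair_inl.
- by rewrite hr copair_inr.
- by rewrite rmorphD hp hq copairD.
- by rewrite rmorphM hp hq copairM.
Qed.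

End Copair.
End Coproduct.

(* D_F[X, X^-1] = D *_F F[X, X^-1], with F the centre of D and X = {x_i}_i<m. *)

Section GeneralizedLaurent.
Variables (D : unitRingType) (m : nat).

Local Notation F := (centerType D).
Local Notation FX := (groupAlg F (freeGroup m)).

Definition genLaurent : Type :=
  @coprod F D FX (@center_val D) (@ga_const F (freeGroup m)).
HB.instance Definition _ := GRing.PzRing.on genLaurent.

Definition dconst (d : D) : genLaurent := inlC _ _ d.
HB.instance Definition _ := GRing.isZmodMorphism.Build D genLaurent dconst
  (inlC_is_additive _ _).
HB.instance Definition _ := GRing.isMonoidMorphism.Build D genLaurent dconst
  (inlC_is_monoid_morphism _ _).

Definition xpow (i : 'I_m) (n : int) : genLaurent :=
  inrC _ _ (ga_elt F (gexpz (fg_gen i) n)).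

Section Subst.
Variable c : 'I_m -> units D.

Definition subst_letter (a : letter m) : D :=
  unit_val (if a.2 then (c a.1)^-1 else c a.1)%g.

Lemma subst_letterV a : subst_letter a * subst_letter (linv a) = 1.
Proof.
by case: a => i [] /=; rewrite /subst_letter /= ?mulVr ?mulrV ?unit_valP.
Qed.

Definition subst_laurent : FX -> D :=
  @ga_lift F (freeGroup m) D (@center_val D) (fg_lift subst_letter).

Lemma subst_laurent_additive : zmod_morphism subst_laurent.
Proof. exact: ga_lift_additive. Qed.
Lemma subst_laurent_monoid_morphism : monoid_morphism subst_laurent.
Proof.
apply: ga_lift_monoid_morphism => [|k l|z k].
- exact: fg_lift1.
- exact: (fg_liftM subst_letterV).
- exact: (centerP _ (center_valP z)).
Qed.
HB.instance Definition _ := GRing.isZmodMorphism.Build FX D subst_laurent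
  subst_laurent_additive.
HB.instance Definition _ := GRing.isMonoidMorphism.Build FX D subst_laurent
  subst_laurent_monoid_morphism.

(* w |-> w(c_1, ..., c_m): the ring morphism to D that is the identity on D   *)
(* and maps x_i to c_i.                                                       *)
Definition subst : genLaurent -> D := copair idfun subst_laurent.

Lemma subst_base (z : F) :
  idfun (center_val z) = subst_laurent (ga_const (freeGroup m) z).
Proof. by rewrite /subst_laurent ga_lift_const //; apply: fg_lift1. Qed.

Lemma subst_additive : zmod_morphism subst.
Proof. exact: copair_additive subst_base. Qed.
Lemma subst_monoid_morphism : monoid_morphism subst.
Proof. exact: copair_monoid_morphism subst_base. Qed.
HB.instance Definition _ := GRing.isZmodMorphism.Build genLaurent D subst
  subst_additive.
HB.instance Definition _ := GRing.isMonoidMorphism.Build genLaurent D subst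
  subst_monoid_morphism.

Lemma subst_dconst d : subst (dconst d) = d.
Proof. exact: (copair_inl subst_base). Qed.

Lemma subst_xpow i n : subst (xpow i n) = unit_val (c i) ^ n.
Proof.
have liftX (k : nat) (s : freeGroup m) :
    fg_lift subst_letter (s ^+ k)%g = fg_lift subst_letter s ^+ k.
  elim: k => [|k IHk]; first by rewrite fg_lift1.
  by rewrite expgS (fg_liftM subst_letterV) IHk exprS.
transitivity (subst_laurent (ga_elt F (gexpz (fg_gen i) n))).
  exact: (copair_inr subst_base).
rewrite /subst_laurent ga_lift_elt; case: n => k /=; first by rewrite liftX fg_lift_gen.
rewrite -expVgn liftX NegzE -exprz_inv -exprnP; congr (_ ^+ _).
by rewrite /fg_lift big_seq1.
Qed.

End Subst.

Definition gg_monomial (w : genLaurent) : Prop :=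
  ~ range dconst w /\
  exists (s : seq (units D * 'I_m * int)) (a : units D),
    w = (\prod_(y <- s) (dconst y.1.1 * xpow y.1.2 y.2)) * dconst a.

Definition gpcgi (H : set (units D)) (w : genLaurent) : Prop :=
  gg_monomial w /\
  forall c : 'I_m -> units D, (forall i, H (c i)) ->
    exists2 p : nat, (0 < p)%N & center D (subst c w ^+ p).

Definition nontrivial_gpcgi (w : genLaurent) : Prop :=
  forall p : nat, (0 < p)%N -> ~ range dconst (w ^+ p).

End GeneralizedLaurent.

(* Main.v *)
Require Import Defs.
From mathcomp Require Import all_boot all_order all_algebra.
From mathcomp Require Import finmap zify.
From mathcomp Require Import boolp classical_sets functions cardinality.

(** The centre F of D being uncountable, an exponent can be made uniform over
infinitely many values of a parameter in F.  Up to conjugation w is either a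
constant, whose powers must then lie in D, or a cyclically reduced monomial.  If N
contains a non-central x, substituting in the latter words of N built from
u x u^-1 u' x u'^-1 and from powers gives a word W in letters X_k, with W(X)
power central for all X in D^*, in which the coefficient between two consecutive
occurrences of the same letter is never central.

Put X_k = 1 + t N_k(s) with N_k in D[s] and t, s in F, and expand in powers of t:
by uniformity in t and then in s, the coefficients of W^p lie in F[s].  Let D[s]
act on D by left multiplications and by s z = z b for a fixed non-central b, so
that F[s] acts by right multiplications.  The N_k can be chosen to act as rank
one operators, of square zero, over the centralizer of b, in general position
with respect to the coefficients of W.  Then the top coefficient of W^p is, up to
a factor in that centralizer, again of rank one: it is not zero but kills a
non-zero vector, which a right multiplication cannot do. *)

Set Implicit Arguments.
Unset Strict Implicit.
Unset Printing Implicit Defensive.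

Import GRing.Theory.

Local Open Scope classical_set_scope.
Local Open Scope ring_scope.

(** * Division rings, polynomials and generic conditions *)

(** The basic exceptional sets of central parameters met below have at most two elements, and their
    finiteness is obtained from this bound. *)
Lemma finite_no3 (T : Type) (A : set T) :
  (forall x y z, A x -> A y -> A z -> x <> y -> x <> z -> y <> z -> False) ->
  finite_set A.
Proof.
move=> A3; have [[x Ax]|A0] := pselect (A !=set0); last first.
  by apply: (@sub_finite_set _ _ set0) => // x Ax; apply: A0; exists x.
have [[y [Ay yx]]|Ax1] := pselect (exists y, A y /\ x <> y).
  apply: (@sub_finite_set _ _ [set x; y]); last by rewrite finite_setU; split; exact: finite_set1.
  move=> z Az; have [->|xz] := pselect (z = x); first by left.
  have [->|yz] := pselect (z = y); first by right.
  by case: (A3 x y z) => // ?; [apply: xz|apply: yz].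
apply: (@sub_finite_set _ _ [set x]); last exact: finite_set1.
by move=> y Ay /=; apply: contrapT => yx; apply: Ax1; exists y; split => // /esym.
Qed.

Lemma finite_seq_union (I : eqType) (T : Type) (s : seq I) (B : I -> set T) :
  (forall i, i \in s -> finite_set (B i)) -> finite_set [set t | exists2 i, i \in s & B i t].
Proof.
elim: s => [|i s IHs] fB; first by apply: (@sub_finite_set _ _ set0) => // t [].
apply: (@sub_finite_set _ _ (B i `|` [set t | exists2 j, j \in s & B j t])).
  by move=> t [j]; rewrite inE => /predU1P[->|js] Bt; [left|right; exists j].
rewrite finite_setU; split; first exact/fB/mem_head.
by apply: IHs => j js; apply: fB; rewrite inE js orbT.
Qed.

Section Center.
Variable R : nzRingType.
Local Notation cen := (center R).

Lemma centerD x y : cen x -> cen y -> cen (x + y).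
Proof. by move=> cx cy z; rewrite mulrDl mulrDr cx cy. Qed.
Lemma centerN x : cen x -> cen (- x).
Proof. by move=> cx z; rewrite mulNr mulrN cx. Qed.

End Center.

Section DivisionRing.
Variable D : unitRingType.
Hypothesis divD : GRing.field_axiom D.

Lemma center_inv (x : D) : center D x -> center D x^-1.
Proof.
move=> cx y; have [->|/divD ux] := eqVneq x 0; first by rewrite invr0 mul0r mulr0.
by apply: (mulrI ux); rewrite mulrA mulrV // mul1r mulrA cx mulrK.
Qed.

Lemma div_mulI (x y z : D) : x != 0 -> x * y = x * z -> y = z.
Proof. by move/divD/mulrI; apply. Qed.

Lemma div_mulIr (x y z : D) : x != 0 -> y * x = z * x -> y = z.
Proof. by move/divD/mulIr; apply. Qed.

Lemma div_mulf_neq0 (x y : D) : x != 0 -> y != 0 -> x * y != 0.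
Proof.
move=> x0; apply: contraNneq => xy0; apply/eqP; apply: (div_mulI x0).
by rewrite mulr0.
Qed.

Lemma div_invr_neq0 (x : D) : x != 0 -> x^-1 != 0.
Proof. by move=> /divD ux; rewrite invr_eq0 //; apply: contraTneq ux => ->; rewrite unitr0. Qed.

Lemma poly_size_mul (p q : {poly D}) : p != 0 -> q != 0 ->
  size (p * q) = (size p + size q).-1.
Proof.
by move=> p0 q0; apply: size_proper_mul; rewrite div_mulf_neq0 ?lead_coef_eq0.
Qed.

Lemma poly_mulf_neq0 (p q : {poly D}) : p != 0 -> q != 0 -> p * q != 0.
Proof.
move=> p0 q0; rewrite -lead_coef_eq0 lead_coef_proper_mul;
by rewrite div_mulf_neq0 ?lead_coef_eq0.
Qed.

(** Central roots commute with each other, so distinct ones satisfy [diff_roots] and the usual bound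
    on the number of roots applies. *)
Lemma central_roots (p : {poly D}) (A : set D) :
  infinite_set A -> (forall x, A x -> center D x /\ p.[x] = 0) -> p = 0.
Proof.
move=> infA rA; have [//|p0] := eqVneq p 0.
have [B BA szB] := infinite_set_fset (size p) infA.
suff: (size (enum_fset B) < size p)%N by rewrite ltnNge szB.
apply: max_ring_poly_roots => //.
  by apply/allP => x xB; apply/rootP; case: (rA x (BA _ xB)).
have : {subset enum_fset B <= B} by [].
have: uniq (enum_fset B) by apply: fset_uniq.
elim: (enum_fset B) => //= x s IHs /andP[xs us] sB; apply/andP; split; last first.
  by apply: IHs => // y ys; apply: sB; rewrite inE ys orbT.
apply/allP => y ys; rewrite /diff_roots.
have /BA/rA[cx _] : x \in B by apply: sB; rewrite inE eqxx.
rewrite (cx y) eqxx /= divD // subr_eq0.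
by apply: contraNneq xs => <-.
Qed.

(** The right Ore condition, by Euclidean division: subtracting [z * t] from [p] lowers its size,
    and a common multiple for the remainder gives one for [p]. If [p] is the shorter one, the roles
    are exchanged. *)
Lemma poly_ore (p z : {poly D}) : z != 0 ->
  exists r q : {poly D}, r != 0 /\ p * r = z * q.
Proof.
have [n] := ubnP (size p + size z); elim: n p z => // n IHn p z.
rewrite ltnS => le_n z0; have [->|p0] := eqVneq p 0.
  by exists 1, 0; rewrite oner_neq0 mul0r mulr0.
have main (p' z' : {poly D}) : p' != 0 -> z' != 0 -> (size z' <= size p')%N ->
    (size p' + size z' <= n)%N -> exists r q : {poly D}, r != 0 /\ p' * r = z' * q.
  move=> p'0 z'0 zp len.
  pose t := ((lead_coef z')^-1 * lead_coef p')%:P * 'X^(size p' - size z').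
  have lp0 : lead_coef p' != 0 by rewrite lead_coef_eq0.
  have uz : lead_coef z' \is a GRing.unit by rewrite divD ?lead_coef_eq0.
  have lt : lead_coef t = (lead_coef z')^-1 * lead_coef p'.
    by rewrite /t lead_coef_Mmonic ?monicXn // lead_coefC.
  have szt : size t = (size p' - size z').+1.
    rewrite /t size_Mmonic ?monicXn //; last first.
      by rewrite polyC_eq0 div_mulf_neq0 ?div_invr_neq0 ?lead_coef_eq0.
    rewrite size_polyC size_polyXn div_mulf_neq0 ?div_invr_neq0 ?lead_coef_eq0 //.
  have t0 : t != 0 by rewrite -size_poly_eq0 szt.
  have lzt : lead_coef (z' * t) = lead_coef p'.
    rewrite lead_coef_proper_mul lt mulrA mulrV // mul1r //.
  have szz : size (z' * t) = size p'.
    rewrite poly_size_mul // szt addnS /= subnKC //.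
  have sz1 : (size (p' - z' * t)%R < size p')%N.
    have psz : (0 < size p')%N by rewrite size_poly_gt0.
    rewrite -(prednK psz) ltnS; apply/leq_sizeP => j.
    rewrite leq_eqVlt coefB => /orP[/eqP <-|].
      by move: lzt; rewrite !lead_coefE szz => ->; rewrite subrr.
    rewrite prednK // => lej; rewrite !nth_default ?subr0 ?szz //.
  have [|r [q [r0 E]]] := IHn (p' - z' * t) z' _ z'0.
    by apply: leq_trans len; rewrite ltn_add2r.
  exists r, (q + t * r); split=> //.
  by rewrite mulrDr -E mulrBl mulrA subrK.
case: (leqP (size z) (size p)) => [zp|/ltnW pz]; first exact: main.
have [|r [q [r0 E]]] := main z p z0 p0 pz; first by rewrite addnC.
exists q, r; split=> //; apply: contraTneq (poly_mulf_neq0 z0 r0) => q0.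
by rewrite E q0 mulr0 eqxx.
Qed.

Section Thin.
Hypothesis infF : infinite_set (center D).

(** A substitute for non-empty open cones, tested on lines with central parameter. *)
Definition generic_cond (C : set D) :=
  [/\ forall v z, C v -> finite_set [set s | center D s /\ ~ C (v + s * z)],
      forall s v, center D s -> s != 0 -> C v -> C (s * v) & exists v, C v].

(** Given [v] for the tail and [z] for [C i], almost every [z + t * v] works: for the tail it is
    rescaled to [v + t^-1 * z], whence the inverses in the exceptional set. *)
Lemma generic_common (I : eqType) (s : seq I) (C : I -> set D) :
  (forall i, i \in s -> generic_cond (C i)) -> exists v, forall i, i \in s -> C i v.
Proof.
elim: s => [|i s IHs] gC; first by exists 0.
have [j js|v Cv] := IHs _; first by apply: gC; rewrite inE js orbT.
have [fi si [z Ciz]] := gC i (mem_head _ _).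
pose B := [set t | center D t /\ ~ C i (z + t * v)] `|` ([set 0] `|`
  [set t^-1 | t in [set t | exists2 j, j \in s & center D t /\ ~ C j (v + t * z)]]).
have finB : finite_set B.
  rewrite /B !finite_setU; split; first exact: fi.
  split; first exact: finite_set1.
  apply: finite_image; apply: finite_seq_union => j js.
  by have [|fj _ _] := gC j; [rewrite inE js orbT|exact/fj/Cv].
have [t [ct Bt]] : (center D `\` B) !=set0.
  apply: infinite_setN0; apply: infinite_setD => //.
have t0 : t != 0 by apply/eqP => t0; apply: Bt; right; left.
exists (z + t * v) => j; rewrite inE => /predU1P[->|js].
  by apply: contrapT => H; apply: Bt; left.
have ut := divD t0.
have -> : z + t * v = t * (v + t^-1 * z) by rewrite mulrDr mulrA mulrV // mul1r addrC.
have [_ sj _] : generic_cond (C j) by apply: gC; rewrite inE js orbT.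
apply: sj => //; apply: contrapT => H; apply: Bt; right; right.
exists t^-1; last by rewrite invrK.
exists j => //; split => //; exact: center_inv.
Qed.

End Thin.
End DivisionRing.

(** * Words and their formal evaluation *)

(* A word is a product of coefficients [inl a] and letters [inr (k, e)], where
   [inr (k, false)] stands for X_k and [inr (k, true)] for its inverse. *)
Definition item (D : unitRingType) : Type := (units D + nat * bool)%type.

Section Words.
Variable D : unitRingType.
Local Notation word := (seq (item D)).
Implicit Types U : word.

Definition inv_item (i : item D) : item D :=
  match i with inl a => inl (a^-1)%g | inr l => inr (l.1, ~~ l.2) end.

Definition inv_word U : word := rev (map inv_item U).

Definition wpow U n : word := flatten (nseq n U).

Section GroupEval.
Variable X : nat -> units D.

Definition gitem (i : item D) : units D :=
  match i with inl a => a | inr l => (if l.2 then (X l.1)^-1 else X l.1)%g end.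

Definition gev U : units D := (\prod_(i <- U) gitem i)%g.

Lemma gev_cons i U : gev (i :: U) = (gitem i * gev U)%g.
Proof. by rewrite /gev big_cons. Qed.

Lemma gev_cat U1 U2 : gev (U1 ++ U2) = (gev U1 * gev U2)%g.
Proof. by rewrite /gev big_cat. Qed.

Lemma gev_inv U : gev (inv_word U) = ((gev U)^-1)%g.
Proof.
elim: U => [|i U IHU]; first by rewrite /gev !big_nil invg1.
rewrite /inv_word /= rev_cons -cats1 gev_cat IHU !gev_cons invgM; congr (_ * _)%g.
by rewrite /gev big_nil mulg1; case: i => [|[k []]] //=; rewrite invgK.
Qed.

Lemma gev_wpow U n : gev (wpow U n) = (gev U ^+ n)%g.
Proof.
elim: n => [|n IHn]; first by rewrite /gev big_nil expg0.
by rewrite expgS -IHn -gev_cat.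
Qed.

End GroupEval.

(* Evaluation of a word on the formal power series with coefficients in V,
   given as functions [nat -> V], when X_k acts as 1 + s n_k, s being the series
   variable. *)
Section SeriesEval.
Variables (V : zmodType) (ca : units D -> V -> V) (n : nat -> V -> V).

Definition shift1 (h : V -> V) (f : nat -> V) i : V :=
  f i + (if i is j.+1 then h (f j) else 0).

Fixpoint unshift1 (h : V -> V) (f : nat -> V) i : V :=
  f i - (if i is j.+1 then h (unshift1 h f j) else 0).

Lemma shift1K h f : unshift1 h (shift1 h f) = f.
Proof.
apply/funext; elim=> [|i IHi] /=; rewrite /shift1; first by rewrite addr0 subr0.
by rewrite IHi addrK.
Qed.

Lemma unshift1K h f : shift1 h (unshift1 h f) = f.
Proof. by apply/funext => -[|i]; rewrite /shift1 /= subrK. Qed.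

Definition sitem (i : item D) (f : nat -> V) : nat -> V :=
  match i with
  | inl a => fun j => ca a (f j)
  | inr l => (if l.2 then unshift1 else shift1) (n l.1) f
  end.

Definition sev U f := foldr sitem f U.

Definition delta (v : V) (j : nat) : V := if j == 0%N then v else 0.

End SeriesEval.

(** With [t] the map [act b ^~ z], or evaluation at a central point, this transports evaluations
    from [{poly D}] to [D]. *)
Lemma sev_natural (V V' : zmodType) (ca : units D -> V -> V) n
    (ca' : units D -> V' -> V') n' (t : V -> V') :
    t 0 = 0 -> (forall x y, t (x + y) = t x + t y) ->
    (forall a x, t (ca a x) = ca' a (t x)) -> (forall k x, t (n k x) = n' k (t x)) ->
  forall U f, t \o sev ca n U f = sev ca' n' U (t \o f).
Proof.
move=> t0 tD ta tn.
have tB x y : t (x - y) = t x - t y.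
  by apply: (addIr (t y)); rewrite -tD !subrK.
elim=> //= i U IHU f; rewrite -IHU; apply/funext; case: i => [a|[k [|]]] j /=.
- exact: ta.
- elim: j => [|j IHj] /=; first by rewrite tB t0.
  by rewrite tB tn IHj.
- by rewrite /shift1 /= tD; case: j => [|j] /=; rewrite ?t0 ?tn.
Qed.

Lemma delta_comp (V V' : zmodType) (t : V -> V') v : t 0 = 0 ->
  t \o delta v = delta (t v).
Proof. by move=> t0; apply/funext => -[|j] /=. Qed.

Definition lmul (a : units D) : D -> D := *%R (unit_val a).

Definition series_mul (f : nat -> D) (q : {poly D}) (i : nat) : D :=
  \sum_(j < i.+1) f (i - j)%N * q`_j.

Lemma series_mul_delta (q : {poly D}) : series_mul (delta 1) q = fun i => q`_i.
Proof.
apply/funext => i; rewrite /series_mul big_ord_recr /= subnn mul1r big1 ?add0r //.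
by move=> j _; rewrite /delta subn_eq0 leqNgt ltn_ord; exact: mul0r.
Qed.

Lemma series_mul_poly (p q : {poly D}) :
  series_mul (fun i => p`_i) q = fun i => (p * q)`_i.
Proof. by apply/funext => i; rewrite coefMr. Qed.

Lemma shift1_series_mul a f (q : {poly D}) :
  shift1 ( *%R a) (series_mul f q) = series_mul (shift1 ( *%R a) f) q.
Proof.
apply/funext => i; rewrite /shift1 /series_mul.
under [RHS]eq_bigr => j _ do rewrite mulrDl.
rewrite big_split /=; congr (_ + _); case: i => [|i].
  by rewrite big_ord1 mul0r.
rewrite mulr_sumr [in RHS]big_ord_recr /= subnn mul0r addr0; apply: eq_bigr => j _.
by rewrite subSn ?mulrA // -ltnS.
Qed.

Lemma sev_series_mul (n : nat -> D) U f (q : {poly D}) :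
  sev lmul (fun k => *%R (n k)) U (series_mul f q) =
  series_mul (sev lmul (fun k => *%R (n k)) U f) q.
Proof.
elim: U => //= i U ->; move: (sev _ _ U f) => {}f; case: i => [a|[k [|]]] /=.
- apply/funext => i; rewrite /series_mul /lmul mulr_sumr.
  by apply: eq_bigr => j _; rewrite mulrA.
- by rewrite -[in LHS](unshift1K ( *%R (n k)) f) -shift1_series_mul shift1K.
- exact: shift1_series_mul.
Qed.

Lemma shift1_poly a (p : {poly D}) :
  shift1 ( *%R a) (fun i => p`_i) = fun i => ((1 + a%:P * 'X) * p)`_i.
Proof.
apply/funext => i; rewrite mulrDl mul1r coefD /shift1 -mulrA; congr (_ + _).
by rewrite -commr_polyX coefCM coefMX; case: i => //=; rewrite mulr0.
Qed.

End Words.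

Section FormalCenter.
Variable D : unitRingType.
Hypothesis divD : GRing.field_axiom D.
Variable n : nat -> D.
Let sevn := sev (@lmul D) (fun k => *%R (n k)).

(** The series of [U] is the fraction [P Q^-1]. An inverse letter puts [(1 + n_k s)^-1] to the left
    of [P]; [poly_ore] gives [P R = (1 + n_k s) P'], so that [P'] becomes the numerator and [Q R]
    the denominator. Both identities are cleared of denominators, so zeros of [Q] do no harm. *)
Lemma word_fraction (U : seq (item D)) : exists P Q : {poly D},
  [/\ Q != 0, sevn U (fun i => Q`_i) = (fun i => P`_i) &
    forall (X : nat -> units D) t, center D t ->
      (forall k, unit_val (X k) = 1 + t * n k) ->
      unit_val (gev X U) * Q.[t] = P.[t]].
Proof.
have hM (p q : {poly D}) t : center D t -> (p * q).[t] = p.[t] * q.[t].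
  move=> ct; by apply: hornerM_comm; rewrite /comm_poly ct.
have hX a t : center D t -> (1 + a%:P * 'X).[t] = 1 + t * a.
  by move=> ct; rewrite hornerD hornerC hornerCM hornerX ct.
elim: U => [|i U [P [Q [Q0 sE gE]]]].
  exists 1, 1; split => //; first exact: oner_neq0.
  by move=> X t _ _; rewrite /gev big_nil mul1r.
case: i => [a|[k [|]]].
- exists (unit_val a *: P), Q; split => //.
    by rewrite /sevn /= -/sevn sE; apply/funext => i; rewrite coefZ.
  move=> X t ct EX; rewrite gev_cons /= -mulrA (gE _ _ ct EX).
  by rewrite hornerZ.
- have /(poly_ore divD P)[R [P' [R0 PR]]] : 1 + (n k)%:P * 'X != 0.
    apply/eqP => /(congr1 (fun p : {poly D} => p`_0)) /eqP.
    by rewrite coefD coef1 coefMX addr0 coef0 oner_eq0.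
  exists P', (Q * R); split; first exact: poly_mulf_neq0.
    rewrite /sevn /= -/sevn -series_mul_poly /sevn sev_series_mul -/sevn sE series_mul_poly PR.
    by rewrite -shift1_poly shift1K.
  move=> X t ct EX; rewrite gev_cons /= hM // mulrA -(mulrA _ _ Q.[t]) (gE _ _ ct EX).
  rewrite -mulrA -hM // PR hM // hX // -EX mulrA mulVr ?mul1r //; exact: unit_valP.
- exists ((1 + (n k)%:P * 'X) * P), Q; split => //.
    by rewrite /sevn /= -/sevn sE shift1_poly.
  by move=> X t ct EX; rewrite gev_cons /= -mulrA (gE _ _ ct EX) hM // hX // -EX.
Qed.

(* Write the series as P Q^-1. Since P(t) Q(t)^-1 is central for infinitely many t,
   P y Q = Q y P for all y; subtracting from P Q^-1 the terms below its first
   non-central coefficient w and comparing lowest terms, w commutes with everything. *)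
Lemma formal_center (U : seq (item D)) (A : set D) : infinite_set A ->
  (forall t, A t -> center D t /\ exists X : nat -> units D,
     (forall k, unit_val (X k) = 1 + t * n k) /\ center D (unit_val (gev X U))) ->
  forall i, center D (sevn U (delta 1) i).
Proof.
move=> infA HA; have [P [Q [Q0 sE gE]]] := word_fraction U.
set w := sevn U (delta 1).
have wQ i : P`_i = \sum_(j < i.+1) w (i - j)%N * Q`_j.
  have := congr1 (fun f => f i) sE; rewrite -series_mul_delta /sevn sev_series_mul -/sevn -/w.
  by move <-.
have PyQ (y : D) : P * y%:P * Q = Q * y%:P * P.
  apply/eqP; rewrite -subr_eq0; apply/eqP; apply: (central_roots divD infA).
  move=> t /HA [ct [X [EX cX]]]; split => //.
  have hM (p q : {poly D}) : (p * q).[t] = p.[t] * q.[t].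
    by apply: hornerM_comm; rewrite /comm_poly ct.
  rewrite hornerD hornerN !hM hornerC -(gE _ _ ct EX) -!mulrA.
  by rewrite (cX (Q.[t] * (y * Q.[t]))) (cX Q.[t]) !mulrA subrr.
have [k [Qk Qlt]] : exists k, Q`_k != 0 /\ forall j, (j < k)%N -> Q`_j = 0.
  have exQ : exists k, Q`_k != 0.
    by exists (size Q).-1; rewrite -lead_coefE lead_coef_eq0.
  exists (ex_minn exQ); case: ex_minnP => k Qk mink; split => // j jk.
  by apply/eqP/negPn/negP => /mink; rewrite leqNgt jk.
elim/ltn_ind => i IHi.
(* By induction [z] is central in [{poly D}], so replacing [P] by [P1] preserves the identity [PyQ],
   and [P1] has no term below degree [i + k]. *)
pose z : {poly D} := \poly_(j < i) w j.
have cz (p : {poly D}) : z * p = p * z.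
  apply/polyP => m; rewrite coefM coefMr; apply: eq_bigr => j _.
  rewrite coef_poly; case: ltnP => [ji|]; last by rewrite mul0r mulr0.
  exact: IHi.
pose P1 := P - z * Q.
have P1E m : P1`_m = \sum_(j < m.+1) (if (m - j < i)%N then 0 else w (m - j)%N) * Q`_j.
  rewrite coefB wQ coefMr -sumrB; apply: eq_bigr => j _.
  by rewrite coef_poly; case: ifP => _; rewrite ?mul0r ?subr0 // subrr.
have P1lt m : (m < i + k)%N -> P1`_m = 0.
  move=> lt; rewrite P1E big1 // => j _; case: ltnP => h; rewrite ?mul0r //.
  rewrite Qlt ?mulr0 //; have := ltn_ord j; lia.
have P1ik : P1`_(i + k) = w i * Q`_k.
  have kl : (k < (i + k).+1)%N by rewrite ltnS leq_addl.
  rewrite P1E (bigD1 (Ordinal kl)) //= addnK ltnn big1 ?addr0 // => j.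
  rewrite -val_eqE /= => jk; have [jlt|jge] := ltnP j k; first by rewrite Qlt ?mulr0.
  case: ltnP => h; rewrite ?mul0r //; have := ltn_ord j; move: jk; lia.
have P1y y : P1 * y%:P * Q = Q * y%:P * P1.
  rewrite /P1 !mulrBl mulrBr PyQ; congr (_ - _).
  by rewrite [RHS]mulrA -(cz (Q * _)) !mulrA.
have low (p q : {poly D}) a b : (forall m, (m < a)%N -> p`_m = 0) ->
    (forall m, (m < b)%N -> q`_m = 0) -> (p * q)`_(a + b) = p`_a * q`_b.
  move=> pl ql; have al : (a < (a + b).+1)%N by rewrite ltnS leq_addr.
  rewrite coefM (bigD1 (Ordinal al)) //= addKn big1 ?addr0 // => j.
  rewrite -val_eqE /= => ja; have [jlt|jge] := ltnP j a; first by rewrite pl ?mul0r.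
  rewrite ql ?mulr0 //; have := ltn_ord j; move: ja; lia.
move=> d.
have uQ := divD Qk.
(* With this [y], comparing coefficients of degree [i + k + k] in [P1y] gives
   [w i * d * Q_k = d * w i * Q_k]. *)
set y := (Q`_k)^-1 * d.
have l1 m : (m < i + k)%N -> (P1 * y%:P)`_m = 0.
  by move=> lt; rewrite coefMC P1lt ?mul0r.
have l2 m : (m < k)%N -> (Q * y%:P)`_m = 0 by move=> lt; rewrite coefMC Qlt ?mul0r.
have := low _ _ _ _ l1 Qlt; rewrite P1y addnC (low _ _ _ _ l2 P1lt) /y.
rewrite !coefMC P1ik !mulrA mulrK // mulrV // mul1r => E.
by apply: (mulIr uQ); rewrite E.
Qed.

End FormalCenter.

(** * The action of D[t] on D *)

Section Action.
Variable D : unitRingType.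
Hypothesis divD : GRing.field_axiom D.
Variable b : D.

(* D as a module over the polynomial ring D[t], D acting by left multiplication
   and t by right multiplication by b. *)
Definition act (f : {poly D}) (z : D) : D := (f * z%:P).[b].

Lemma actD f g z : act (f + g) z = act f z + act g z.
Proof. by rewrite /act mulrDl hornerD. Qed.

Lemma actN f z : act (- f) z = - act f z.
Proof. by rewrite /act mulNr hornerN. Qed.

Lemma act0 z : act 0 z = 0.
Proof. by rewrite /act mul0r horner0. Qed.

Lemma actDr f x y : act f (x + y) = act f x + act f y.
Proof. by rewrite /act polyCD mulrDr hornerD. Qed.

Lemma actr0 f : act f 0 = 0.
Proof. by rewrite /act polyC0 mulr0 horner0. Qed.

Lemma actNr f z : act f (- z) = - act f z.
Proof. by rewrite /act polyCN mulrN hornerN. Qed.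

Lemma actC c z : act c%:P z = c * z.
Proof. by rewrite /act -polyCM hornerC. Qed.

Lemma actMX f z : act (f * 'X) z = act f z * b.
Proof. by rewrite /act -mulrA -commr_polyX mulrA hornerMX. Qed.

Lemma actX z : act 'X z = z * b.
Proof. by rewrite -['X]mul1r actMX -[1]/(1%:P) actC mul1r. Qed.

Lemma actCM c f z : act (c%:P * f) z = c * act f z.
Proof. by rewrite /act -mulrA hornerCM. Qed.

Lemma actM f g z : act (f * g) z = act f (act g z).
Proof.
elim/poly_ind: f => [|f c IHf]; first by rewrite mul0r !act0.
by rewrite mulrDl !actD actC actCM actMX -IHf -mulrA -commr_polyX mulrA actMX.
Qed.

(** Left multiplications and right multiplication by [b] are linear for the right action of the
    centralizer E of [b]; rank and lines below refer to this structure. *)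
Lemma act_comm f z e : GRing.comm b e -> act f (z * e) = act f z * e.
Proof.
move=> ce; elim/poly_ind: f => [|f c IHf]; first by rewrite !act0 mul0r.
by rewrite !actD !actC !actMX IHf mulrDl -!mulrA ce.
Qed.

Lemma act_central (f : {poly D}) z : (forall i, center D f`_i) -> act f z = z * f.[b].
Proof.
move=> cf; rewrite /act; have -> : f * z%:P = z%:P * f.
  by apply/polyP => i; rewrite coefMC coefCM cf.
exact: hornerCM.
Qed.

Lemma act_XsubC c z : act ('X - c%:P) z = z * b - c * z.
Proof. by rewrite actD actN actX actC. Qed.

Lemma comm_center s : center D s -> GRing.comm b s.
Proof. by move=> cs; rewrite /GRing.comm cs. Qed.

(** The kernel of [t - u b u^-1] is the line [u E]: this is [z b = u b u^-1 z] multiplied by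
    [u^-1]. *)
Lemma act_conj_eq0 u z : u != 0 ->
  (act ('X - (u * b * u^-1)%:P) z == 0) <-> GRing.comm b (u^-1 * z).
Proof.
move=> /divD uu; rewrite act_XsubC subr_eq0; split => [/eqP E|E].
  by rewrite /GRing.comm -[RHS]mulrA E !mulrA mulVr // mul1r.
by apply/eqP; rewrite -!mulrA E !mulrA mulrV // mul1r.
Qed.

Section Generic.
Hypothesis ncb : ~ center D b.

Lemma noncomm_exists : exists d, ~ GRing.comm b d.
Proof.
apply: contrapT => H; apply: ncb => d.
by apply: contrapT => Hd; apply: H; exists d.
Qed.

(** If two points of a line [v + s * z] lie in [u E], so do [z] and [v], since central elements
    belong to E. *)
Lemma generic_line u : u != 0 -> generic_cond (fun v => ~ GRing.comm b (u^-1 * v)).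
Proof.
move=> u0; split=> [v z Cv|s v cs s0|].
- apply: finite_no3 => s t _ [cs /contrapT bs] [ct /contrapT bt] _ st _ _; apply: Cv.
  have st0 : s - t != 0 by rewrite subr_eq0; apply/eqP.
  have cz : GRing.comm b (u^-1 * z).
    have -> : u^-1 * z = (s - t)^-1 * (u^-1 * (v + s * z) - u^-1 * (v + t * z)).
      rewrite -mulrBr opprD addrACA subrr add0r -mulrBl (mulrA u^-1).
      have cst : center D (s - t) by apply: centerD => //; exact: centerN.
      by rewrite -(cst u^-1) -mulrA mulKr // divD.
    apply: commrM; last by apply: commrB.
    by apply/commrV/comm_center/centerD => //; exact: centerN.
  have -> : u^-1 * v = u^-1 * (v + s * z) - s * (u^-1 * z).
    by rewrite mulrDr !mulrA (cs u^-1) addrK.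
  by apply: commrB => //; apply: commrM => //; exact: comm_center.
- apply: contra_not => H.
  have -> : u^-1 * v = s^-1 * (u^-1 * (s * v)).
    by rewrite !mulrA -[_ * u^-1 * s]mulrA -(cs u^-1) !mulrA mulVr ?mul1r // divD.
  by apply: commrM => //; apply/commrV/comm_center.
- have [d Hd] := noncomm_exists; exists (u * d).
  by rewrite mulKr // divD.
Qed.

(** The condition excludes eigenvectors, with eigenvalue in E, of left multiplication by [a]. Of
    three eigenvectors [v0 + s * z], if the first, [v1], is non-zero, either all eigenvalues agree
    or [z] lies in [v1 E]; in each case [v0] is itself an eigenvector. *)
Lemma generic_conj a : ~ center D a ->
  generic_cond (fun v => ~ exists2 e, GRing.comm b e & a * v = v * e).
Proof.
move=> nca; split=> [v0 z Cv|s v cs s0|].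
- have v00 : v0 != 0.
    by apply/eqP => v00; apply: Cv; exists 0; [exact: commr0|rewrite v00 mulr0 mul0r].
  apply: finite_no3 => s1 s2 s3 [c1 /contrapT[e1 ce1 E1]] [c2 /contrapT[e2 ce2 E2]].
  move=> [c3 /contrapT[e3 ce3 E3]] s12 s13 s23; apply: Cv.
  set v1 := v0 + s1 * z in E1.
  have v0E : v0 = v1 - s1 * z by rewrite /v1 addrK.
  have [v10|v1n0] := eqVneq v1 0.
    have ct : center D (s2 - s1) by apply: centerD => //; exact: centerN.
    have t0 : s2 - s1 != 0 by rewrite subr_eq0; apply/eqP => /esym.
    exists e2 => //; rewrite v0E v10 sub0r mulrN mulNr mulrA -c1 -!mulrA; congr (- (_ * _)).
    apply: (div_mulI divD t0); rewrite mulrA ct -mulrA [in RHS]mulrA.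
    have zE : v0 + s2 * z = (s2 - s1) * z by rewrite v0E v10 sub0r mulrBl addrC.
    by move: E2; rewrite zE.
  (* Subtracting the eigenvector equation of [v1] determines [a * z]; the two expressions for [s2]
     and [s3] are then compared. *)
  have step s e : center D s -> s1 <> s -> a * (v0 + s * z) = (v0 + s * z) * e ->
      a * z = z * e + (s - s1)^-1 * v1 * (e - e1).
    move=> cs ss E; have ct : center D (s - s1) by apply: centerD => //; exact: centerN.
    have t0 : s - s1 != 0 by rewrite subr_eq0; apply/eqP => /esym.
    have vE : v0 + s * z = v1 + (s - s1) * z by rewrite v0E mulrBl -addrA [- _ + _]addrC.
    move: ct t0 vE; set t := s - s1; clearbody t => ct t0 vE.
    apply: (div_mulI divD t0); rewrite mulrA ct -mulrA mulrDr !mulrA mulrV ?divD // mul1r.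
    move: E; rewrite vE mulrDr mulrDl E1 => E; apply: (addrI (v1 * e1)).
    by rewrite -(mulrA a) E mulrBr [RHS]addrC -addrA subrK addrC.
  have E2' := step _ _ c2 s12 E2; have E3' := step _ _ c3 s13 E3.
  have [e23|ne23] := eqVneq e2 e3.
    have e12 : e1 = e2.
      apply/eqP; rewrite eq_sym -subr_eq0; apply: contraT => ne.
      have := E2'; rewrite E3' e23 => /addrI /(div_mulIr divD).
      rewrite -e23 => /(_ ne) /(div_mulIr divD v1n0) /invr_inj /addIr /esym /s23 [].
    exists e1 => //; rewrite v0E mulrBr mulrBl E1 mulrA -c1 -mulrA E2' -e12 subrr.
    by rewrite mulr0 addr0 mulrA.
  have zE : exists2 x, GRing.comm b x & z = v1 * x.
    have t0 : e2 - e3 != 0 by rewrite subr_eq0.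
    have c21 : center D (s2 - s1)^-1 by apply/(center_inv divD)/centerD => //; exact: centerN.
    have c31 : center D (s3 - s1)^-1 by apply/(center_inv divD)/centerD => //; exact: centerN.
    exists (((s3 - s1)^-1 * (e3 - e1) - (s2 - s1)^-1 * (e2 - e1)) / (e2 - e3)).
      apply: commrM; last by apply/commrV/commrB.
      by apply: commrB; apply: commrM; rewrite ?comm_center //; apply: commrB.
    apply: (div_mulIr divD t0); rewrite mulrA mulrVK ?divD //.
    rewrite [LHS]mulrBr [RHS]mulrBr !mulrA -(c21 v1) -(c31 v1).
    apply/eqP; rewrite subr_eq addrAC eq_sym subr_eq; apply/eqP.
    by rewrite -E2' addrC -E3'.
  have [x cx zx] := zE.
  have v0x : v0 = v1 * (1 - s1 * x).
    by rewrite v0E mulrBr mulr1 zx !mulrA c1.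
  have x0 : 1 - s1 * x != 0 by apply: contraNneq v00 => x0; rewrite v0x x0 mulr0.
  have cxx : GRing.comm b (1 - s1 * x).
    by apply: commrB; [exact: commr1|apply: commrM => //; exact: comm_center].
  exists ((1 - s1 * x)^-1 * e1 * (1 - s1 * x)).
    by apply: commrM => //; apply: commrM => //; exact: commrV.
  by rewrite v0x !mulrA E1 mulrK ?divD.
- apply: contra_not => -[e ce E]; exists e; [by []|]; apply: (div_mulI divD s0).
  by rewrite (mulrA s a) (cs a) -(mulrA a) E mulrA.
(* If all vectors are eigenvectors, then so are 1, [v] and [1 + v]: [a] is in E, and for [v] outside
   E the eigenvalue has to be [a]. An element of E is a difference of two elements outside E. *)
- apply: contrapT => H; apply: nca.
  have {}H v : exists2 e, GRing.comm b e & a * v = v * e.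
    by apply: contrapT => Hv; apply: H; exists v.
  have ca : GRing.comm b a by have [e ce] := H 1; rewrite mulr1 mul1r => ->.
  have main v : ~ GRing.comm b v -> a * v = v * a.
    move=> nv; have [e ce E] := H v; have [e' ce' E'] := H (1 + v).
    have [ee|ne] := eqVneq e e'.
      move: E'; rewrite mulrDr mulrDl mulr1 mul1r E ee => /addIr ae.
      by rewrite ae.
    case: nv; have t0 : e - e' != 0 by rewrite subr_eq0.
    have -> : v = (e' - a) / (e - e').
      apply: (div_mulIr divD t0); rewrite mulrVK ?divD // mulrBr -E.
      move: E'; rewrite mulrDr mulrDl mulr1 mul1r => E'.
      by apply: (addrI a); rewrite addrA E' addrK addrC subrK.
    by apply: commrM; [apply: commrB|apply/commrV/commrB].
  move=> v; have [nv|cv] := pselect (~ GRing.comm b v); first exact: main.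
  have [u nu] := noncomm_exists; have nuv : ~ GRing.comm b (u + v).
    move=> cuv; apply: nu; rewrite -[u](addrK v); apply: commrB => //; exact: contrapT.
  by have := main _ nuv; rewrite mulrDr mulrDl main // => /addrI.
Qed.

End Generic.
End Action.

(** * Functionals with values in the centralizer, and vectors in general position *)

Section System.
Variable D : unitRingType.
Hypothesis divD : GRing.field_axiom D.
Hypothesis infF : infinite_set (center D).
Variable b : D.
Hypothesis ncb : ~ center D b.
Local Notation act := (act b).
Local Notation comm := (GRing.comm b).

(** The values stay in E when [h] is composed with a left multiplication by [y], and not killing a
    given non-zero [z] is a generic condition on [y]. *)
Lemma functional_exact (h : {poly D}) z0 : act h z0 != 0 ->
  (forall z, comm (act h z)) -> forall Om : seq D, (forall z, z \in Om -> z != 0) ->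
  exists y : {poly D}, (forall z, z \in Om -> act y z != 0) /\ forall z, comm (act y z).
Proof.
move=> hz0 hE Om Om0.
have actZ f s z : center D s -> act f (s * z) = s * act f z.
  by move=> cs; rewrite cs act_comm -?cs //; exact: comm_center.
have [|y Hy] := @generic_common D divD infF _ Om (fun z => [set y | act h (y * z) != 0]).
  move=> z zOm; split=> [v x hv|s v cs s0 hv|].
  - apply: finite_no3 => s t _ [cs /negP/negPn/eqP bs] [ct /negP/negPn/eqP bt] _ st _ _.
    move/eqP: hv; apply.
    have t0 : s - t != 0 by rewrite subr_eq0; apply/eqP.
    move: bs bt; rewrite !mulrDl -!mulrA !actDr (actZ h s _ cs) (actZ h t _ ct) => bs bt.
    have hx : act h (x * z) = 0.
      apply: (div_mulI divD t0); rewrite mulr0 mulrBl.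
      by apply: (addrI (act h (v * z))); rewrite addrA bs addr0 -bt addrK.
    by move: bs; rewrite hx mulr0 addr0.
  - by rewrite /= -mulrA actZ // div_mulf_neq0.
  - by exists (z0 * z^-1); rewrite /= mulrVK // divD // Om0.
exists (h * y%:P); split=> z => [zOm|]; rewrite actM actC //; exact: Hy.
Qed.

(* Two vectors z1, z2 independent over the centralizer E of b are mapped to the
   same E-line, without killing any given vector, by t - u b u^-1 for almost all
   u = z2 - s z1 with s central: this operator has kernel u E. *)
Lemma functional_finite (Om : seq D) : (forall z, z \in Om -> z != 0) ->
  exists y : {poly D}, forall z, z \in Om -> act y z != 0 /\ comm (act y z).
Proof.
have [n] := ubnP (size Om); elim: n Om => // n IHn [|z1 [|z2 r]] szn Om0.
- by exists 1.
- exists (z1^-1)%:P => z; rewrite inE => /eqP ->; rewrite actC mulVr; last exact/divD/Om0/mem_head.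
  by split; [exact: oner_neq0|exact: commr1].
have z10 : z1 != 0 by apply: Om0; rewrite mem_head.
have [c12|nc12] := pselect (comm (z1^-1 * z2)).
  have [||y Hy] := IHn (z1 :: r); first by rewrite -ltnS.
    by move=> z zr; apply: Om0; move: zr; rewrite !inE => /orP[->|->]; rewrite ?orbT.
  exists y => z; rewrite !inE => /or3P[/eqP->|/eqP->|zr].
  - by apply: Hy; rewrite mem_head.
  - have [y1 cy1] := Hy z1 (mem_head _ _).
    have z20 : z2 != 0 by apply: Om0; rewrite !inE eqxx orbT.
    rewrite -(mulVKr (divD z10) z2) act_comm //; split; last exact: commrM.
    by do 2!apply: div_mulf_neq0 => //; exact: div_invr_neq0.
  - by apply: Hy; rewrite inE zr orbT.
(* For these [s] the vector [z] would be killed. As [0^-1 = 0], the case [u = 0] is also bad. Two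
   bad values would put [z1] and [z2] on the line [z E], against [nc12]. *)
pose bad z := [set s | center D s /\ comm ((z2 - s * z1)^-1 * z)].
have badF z : z \in z1 :: z2 :: r -> finite_set (bad z).
  move=> /Om0 z0; apply: finite_no3 => s t _ [cs bs] [ct bt] _ st _ _; apply: nc12.
  have t0 : s - t != 0 by rewrite subr_eq0; apply/eqP.
  have flip u : comm (u^-1 * z) -> comm (z^-1 * u).
    have [->|u0] := eqVneq u 0; first by rewrite mulr0 => _; exact: commr0.
    by move=> /commrV; rewrite invrM ?invrK ?unitrV ?divD.
  have cst : center D (s - t) by apply: centerD => //; exact: centerN.
  have [{}bs {}bt] := (flip _ bs, flip _ bt).
  have c1 : comm (z^-1 * z1).
    have E : z2 - t * z1 - (z2 - s * z1) = (s - t) * z1.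
      by rewrite opprB addrC addrA subrK mulrBl.
    have -> : z^-1 * z1 = (s - t)^-1 * (z^-1 * (z2 - t * z1) - z^-1 * (z2 - s * z1)).
      by rewrite -mulrBr E (mulrA z^-1) -(cst z^-1) -mulrA mulKr // divD.
    by apply: commrM; [apply/commrV/comm_center|apply: commrB].
  have c2 : comm (z^-1 * z2).
    have -> : z^-1 * z2 = z^-1 * (z2 - s * z1) + s * (z^-1 * z1).
      by rewrite (mulrA s) (cs z^-1) -mulrA -mulrDr subrK.
    by apply: commrD => //; apply: commrM => //; exact: comm_center.
  have -> : z1^-1 * z2 = (z^-1 * z1)^-1 * (z^-1 * z2).
    by rewrite invrM ?unitrV ?divD // invrK -mulrA mulVKr ?divD.
  by apply: commrM => //; exact: commrV.
have [s [cs Hs]] : (center D `\` [set s | exists2 z, z \in z1 :: z2 :: r & bad z s]) !=set0.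
  by apply: infinite_setN0; apply: infinite_setD => //; exact: finite_seq_union.
set u := z2 - s * z1 in Hs.
have u0 : u != 0.
  apply/eqP => u0; apply: Hs; exists z1; first exact: mem_head.
  by split=> //; rewrite -/u u0 invr0 mul0r; exact: commr0.
pose g := 'X - (u * b * u^-1)%:P : {poly D}.
have g0 z : z \in z1 :: z2 :: r -> act g z != 0.
  move=> zr; apply/negP => /(act_conj_eq0 divD _ _ u0) cz; apply: Hs.
  by exists z.
have [||y Hy] := IHn (act g z1 :: map (act g) r).
- by rewrite /= size_map -ltnS.
- move=> w; rewrite inE => /predU1P[->|/mapP[z zr ->]]; apply: g0; rewrite !inE ?eqxx //.
  by rewrite zr !orbT.
exists (y * g) => z; rewrite actM !inE => /or3P[/eqP->|/eqP->|zr].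
- by apply: Hy; rewrite mem_head.
- have [y1 cy1] := Hy (act g z1) (mem_head _ _).
  have -> : z2 = u + z1 * s by rewrite /u -cs subrK.
  have gu : act g u = 0.
    by apply/eqP/(act_conj_eq0 divD) => //; rewrite mulVr ?divD //; exact: commr1.
  have s0 : s != 0.
    by apply/eqP => s0; move: (g0 z2); rewrite !inE eqxx orbT -[z2](subrK (s * z1)) -/u s0 mul0r addr0 gu eqxx => /(_ isT).
  have css := comm_center b cs.
  rewrite actDr gu add0r act_comm // act_comm //; split; last exact: commrM.
  by rewrite div_mulf_neq0.
- by apply: Hy; rewrite inE map_f ?orbT.
Qed.

Lemma generic_vectors (S : seq (units D)) (n : nat) : exists v : nat -> D,
  (forall i, (i < n)%N -> v i != 0) /\
  forall i j (a : units D), (i < n)%N -> (j < n)%N -> a \in S ->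
    i <> j \/ ~ center D (unit_val a) -> ~ comm ((v i)^-1 * (unit_val a * v j)).
Proof.
have uD (a : units D) : unit_val a != 0.
  by apply: contraTneq (unit_valP a) => ->; rewrite unitr0.
elim: n => [|n [v [v0 vS]]]; first by exists (fun=> 0).
(* Conditions on the new vector [w]: [None] makes it non-zero, [Some (a, None)] treats the pair of
   [w] with itself, and [Some (a, Some (j, e))] the pair of [w] and [v j], [e] telling on which side
   [w] stands. *)
pose C (x : option (units D * option (nat * bool))) : set D :=
  match x with
  | None => fun w => ~ comm (1^-1 * w)
  | Some (a, None) => if `[< center D (unit_val a) >] then fun w => ~ comm (1^-1 * w)
      else fun w => ~ exists2 e, comm e & unit_val a * w = w * e
  | Some (a, Some (j, e)) => fun w => ~ comm (((if e then (unit_val a)^-1 else unit_val a) * v j)^-1 * w)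
  end.
pose I := None :: [seq Some (a, None) | a <- S] ++
  [seq Some (a, Some p) | a <- S, p <- [seq (j, e) | j <- iota 0 n, e <- [:: true; false]]].
have [|w Hw] := @generic_common D divD infF _ I C.
  move=> x; rewrite inE => /predU1P[->|]; first exact: (generic_line divD ncb (oner_neq0 _)).
  rewrite mem_cat => /orP[/mapP[a aS ->]|/allpairsPdep[a [_ [aS /allpairsPdep[j [e [jn _ ->]]] ->]]]] /=.
    case: asboolP => [_|]; first exact: (generic_line divD ncb (oner_neq0 _)).
    exact: generic_conj.
  apply: generic_line => //; rewrite mem_iota in jn.
  by apply: div_mulf_neq0 => //; [case: e; rewrite ?div_invr_neq0|apply: v0].
have w0 : w != 0.
  by have := Hw None (mem_head _ _); apply: contra_notN => /eqP ->; rewrite mulr0; exact: commr0.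
have memI a j e : a \in S -> (j < n)%N -> Some (a, Some (j, e)) \in I.
  move=> aS jn; rewrite inE mem_cat; apply/orP; right; apply/orP; right.
  apply/allpairsPdep; exists a, (j, e); split => //.
  by apply/allpairsPdep; exists j, e; split => //; rewrite ?mem_iota //; case: e.
have lt_n i : (i < n.+1)%N -> i <> n -> (i < n)%N by lia.
exists (fun i => if i == n then w else v i); split=> [i|i j a].
  by case: (i =P n) => //= ni /lt_n/(_ ni); exact: v0.
case: (i =P n) => [->|ni] /=; case: (j =P n) => [->|nj] // lin ljn.
- move=> aS [//|na] cw; have := Hw (Some (a, None)); rewrite /C.
  case: asboolP => // _; apply; first by rewrite inE mem_cat map_f.
  exists (w^-1 * (unit_val a * w)) => //.
  by rewrite mulVKr ?divD.
- move: ljn => /lt_n/(_ nj) jn aS _; apply: contra_not (Hw _ (memI a j false aS jn)) => /= /commrV.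
  by rewrite !invrM ?invrK ?mulrA //; rewrite ?unitrV divD // ?div_mulf_neq0 ?v0.
- move: lin => /lt_n/(_ ni) lin aS _; apply: contra_not (Hw _ (memI a i true aS lin)) => /=.
  by rewrite invrM ?invrK ?mulrA // ?unitrV ?divD ?v0.
- exact: vS (lt_n _ lin ni) (lt_n _ ljn nj).
Qed.

End System.

(** * Rank one operators in general position *)

(* Exponents are ignored: unlike in a reduced word, the coefficient a has to be
   non-central also in X_k a X_k. *)
Inductive chain (D : unitRingType) : nat -> nat -> seq (item D) -> Prop :=
| chain_letter k e : chain k k [:: inr (k, e)]
| chain_cat k k' l l' (a : units D) U U' : chain k k' U -> chain l l' U' ->
    k' <> l \/ ~ center D (unit_val a) -> chain k l' (U ++ inl a :: U').

Section PingPong.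
Variable D : unitRingType.
Hypothesis divD : GRing.field_axiom D.
Variable b : D.
Local Notation act := (act b).
Local Notation comm := (GRing.comm b).
Local Notation word := (seq (item D)).

Definition amul (A : seq (units D)) (z : D) : D := foldr (fun a x => unit_val a * x) z A.

Lemma amulD A x y : amul A (x + y) = amul A x + amul A y.
Proof. by elim: A => //= a A ->; rewrite mulrDr. Qed.
Lemma amul0 A : amul A 0 = 0.
Proof. by elim: A => //= a A ->; rewrite mulr0. Qed.
Lemma amulM A x e : amul A (x * e) = amul A x * e.
Proof. by elim: A => //= a A ->; rewrite mulrA. Qed.
Lemma amul_rcons A a x : amul (rcons A a) x = amul A (unit_val a * x).
Proof. by rewrite /amul foldr_rcons. Qed.

Variables (S : seq (units D)) (n : nat).

Section Vectors.
Variables (v : nat -> D) (N : nat -> {poly D}).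

(* Up to k further multiplications by elements of S, every N_i maps z into the
   line spanned by v_i over the centralizer of b. *)
Definition good k z := forall A, {subset A <= S} -> (size A <= k)%N ->
  forall i, (i < n)%N -> comm ((v i)^-1 * act (N i) (amul A z)).

(** The [N i] behave like rank one operators of image [v_i E] and square zero, as far as products of
    at most [K] elements of [S] can detect. *)
Definition ping_pong K :=
  [/\ forall i, (i < n)%N -> v i != 0, forall i, (n <= i)%N -> N i = 0,
    forall i, (i < n)%N -> act (N i) (v i) = 0,
    forall i j (a : units D), (i < n)%N -> (j < n)%N -> a \in S ->
      i <> j \/ ~ center D (unit_val a) -> act (N i) (unit_val a * v j) != 0 &
    forall i, (i < n)%N -> good K (v i)].

Lemma good_le k k' z : (k' <= k)%N -> good k z -> good k' z.
Proof. by move=> le gz A AS szA; apply: gz => //; exact: leq_trans le. Qed.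

Lemma goodD k x y : good k x -> good k y -> good k (x + y).
Proof.
move=> gx gy A AS szA i li; rewrite amulD actDr mulrDr.
by apply: commrD; [apply: gx|apply: gy].
Qed.

Lemma good0 k : good k 0.
Proof. by move=> A _ _ i _; rewrite amul0 actr0 mulr0; exact: commr0. Qed.

Lemma goodM k x e : good k x -> comm e -> good k (x * e).
Proof.
move=> gx ce A AS szA i li; rewrite amulM act_comm // mulrA.
by apply: commrM => //; apply: gx.
Qed.

Lemma good_mul k (a : units D) x : a \in S -> good k.+1 x -> good k (unit_val a * x).
Proof.
move=> aS gx A AS szA; rewrite -amul_rcons; apply: gx; last by rewrite size_rcons.
by move=> c; rewrite mem_rcons inE => /predU1P[->|/AS].
Qed.

(** The coefficient of highest degree: each letter contributes its [N k], with a sign for an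
    inverse. *)
Fixpoint top (U : word) (z : D) : D :=
  match U with
  | [::] => z
  | inl a :: U' => unit_val a * top U' z
  | inr (k, e) :: U' => (if e then -%R else id) (act (N k) (top U' z))
  end.

Definition wf_item (i : item D) := match i with inl a => a \in S | inr l => (l.1 < n)%N end.
Definition is_letter (i : item D) := match i with inl _ => false | inr _ => true end.
Local Notation wf := (all wf_item).
Local Notation nlet := (count is_letter).

Lemma top_cat U U' z : top (U ++ U') z = top U (top U' z).
Proof. by elim: U => [//|[a|[k e]] U IHU] /=; rewrite IHU. Qed.

Section WithPingPong.
Variable K : nat.
Hypothesis pp : ping_pong K.

Lemma good_line k z i : good k z -> (i < n)%N ->
  exists2 e, comm e & act (N i) z = v i * e.
Proof.
move=> gz li; exists ((v i)^-1 * act (N i) z); first exact: (gz [::]).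
by case: pp => v0 _ _ _ _; rewrite mulVKr // divD // v0.
Qed.

(** Each coefficient uses up one unit of goodness, but a letter restores it up to [K]: the result is
    in [v_i E]. *)
Lemma good_N k k' z i : good k z -> (i < n)%N -> (k' <= K)%N -> good k' (act (N i) z).
Proof.
move=> gz li lk; have [e ce ->] := good_line gz li; apply: goodM => //.
by case: pp => _ _ _ _ gv; apply: good_le lk _; apply: gv.
Qed.

(* On good vectors N_i^2 vanishes, so that 1 + s N_i has inverse 1 - s N_i. *)
Lemma top_degree U k d f : wf U -> (size U + k <= K)%N ->
  (forall i, (d < i)%N -> f i = 0) -> (forall i, good (size U + k) (f i)) ->
  let g := sev (@lmul D) (fun k => act (N k)) U f in
  [/\ forall i, (d + nlet U < i)%N -> g i = 0, forall i, good k (g i) &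
      g (d + nlet U)%N = top U (f d)].
Proof.
move=> wfU szU f0 gf g; rewrite {}/g.
elim: U k wfU szU f0 gf => [|it U IHU] k /= wfU szU f0 gf; first by rewrite addn0.
case/andP: wfU => wfi wfU.
have szE : (size U + k.+1 = (size U).+1 + k)%N by rewrite addnS.
have [] := IHU k.+1 wfU _ f0 _; rewrite ?szE // => g0 gg gE.
move: (sev _ _ _ _) g0 gg gE => g g0 gg gE.
case: it wfi => [a|[j e]] /= wfi.
  rewrite add0n gE; split => // i; last exact: good_mul.
  by move=> /g0 ->; rewrite /lmul mulr0.
have kK : (k <= K)%N by lia.
have gk i : good k (g i) by apply: good_le (gg i).
pose t := if e then - 1 else 1 : D.
have hE i : (if e then @unshift1 D else @shift1 D) (act (N j)) g i =
    g i + (if i is i'.+1 then act (N j) (g i') * t else 0).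
  rewrite /t; case: e {t}; last by rewrite /shift1; case: i => [//|i]; rewrite mulr1.
  have sq x : act (N j) (act (N j) (g x)) = 0.
    have [c cc ->] := good_line (gg x) wfi; case: pp => _ _ Nv _ _.
    by rewrite act_comm // Nv // mul0r.
  elim: i => [|i IHi] /=; first by rewrite subr0 addr0.
  rewrite mulrN1 IHi actDr; congr (_ - _); case: (i) => [|j']; first by rewrite actr0 addr0.
  by rewrite mulrN1 actNr sq oppr0 addr0.
have gh i : good k ((if e then @unshift1 D else @shift1 D) (act (N j)) g i).
  rewrite hE; apply: goodD => //; case: i => [|i]; first exact: good0.
  apply: goodM; first exact: good_N (gg i) wfi kK.
  by rewrite /t; case: (e); [apply/commrN/commr1|exact: commr1].
split=> // [i lti|]; rewrite hE.
  rewrite g0 ?add0r; last by lia.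
  case: i lti => [//|i] lti; rewrite g0 ?actr0 ?mul0r //; lia.
rewrite addnCA add1n g0 ?add0r ?gE; last by rewrite ltnS leqnn.
by rewrite /t; case: (e) => /=; rewrite ?mulrN1 ?mulr1.
Qed.

Lemma chain_lt k k' U : chain k k' U -> wf U -> (k < n)%N /\ (k' < n)%N.
Proof.
elim=> {k k' U} [k e|k k' l l' a U U' _ IH1 _ IH2 _] /=; first by rewrite andbT.
by rewrite all_cat /= => /and3P[/IH1[kn _] _ /IH2[_ ln]].
Qed.

(* The leading term of a chain is, up to a right factor in the centralizer of b,
   the rank one operator z |-> v_k N_k'(z). *)
Lemma chain_top k k' U z : chain k k' U -> wf U -> (size U <= K)%N ->
  good (size U) z ->
  (exists2 e, comm e & top U z = v k * e) /\ (top U z = 0 <-> act (N k') z = 0).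
Proof.
move=> cU; elim: cU z => {k k' U} [k e|k k' l l' a U U' cU IHU cU' IHU' kl] z.
  rewrite /= andbT => kn _ gz; split; last first.
    by case: e => //=; split => [/eqP|->]; rewrite ?oppr0 // oppr_eq0 => /eqP.
  have [c cc ->] := good_line gz kn; case: e; last by exists c.
  by exists (- c); [exact: commrN|rewrite mulrN].
rewrite all_cat top_cat size_cat /= => /and3P[wU aS wU'] szK gz.
have [_ k'n] := chain_lt cU wU; have [ln _] := chain_lt cU' wU'.
have [||[e ce E] E0] := IHU' z wU'; [lia|by apply: good_le gz; lia|].
have [v0 _ _ Nnz gv] := pp.
have ga : good (size U) (unit_val a * v l).
  by apply: good_mul => //; apply: good_le (gv _ ln); lia.
have [||Ue U0] := IHU (unit_val a * (v l * e)) wU; first lia.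
  by rewrite mulrA; apply: goodM.
rewrite E; split=> //; rewrite -E0 E U0 mulrA act_comm //.
have Nn0 := Nnz _ _ _ k'n ln aS kl.
split=> [/eqP H|/eqP H].
  suff -> : e = 0 by rewrite mulr0.
  by apply/eqP; apply: contraTT H => e0; exact: div_mulf_neq0.
suff -> : e = 0 by rewrite mulr0.
by apply/eqP; apply: contraTT H => e0; apply: div_mulf_neq0 => //; exact: v0.
Qed.

End WithPingPong.
End Vectors.
End PingPong.

(** * Construction of the operators *)

Section Exist.
Variable D : unitRingType.
Hypothesis divD : GRing.field_axiom D.
Hypothesis infF : infinite_set (center D).
Variable b : D.
Hypothesis ncb : ~ center D b.
Local Notation act := (act b).
Local Notation comm := (GRing.comm b).
Local Notation word := (seq (item D)).

(** [T] tells whether values in the centralizer of [b] are available on all of [D] or only on a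
    prescribed finite set, so that both cases share one construction. *)
Definition functionals (T : Prop) := forall Om : seq D, (forall z, z \in Om -> z != 0) ->
  exists y : {poly D}, (forall z, z \in Om -> act y z != 0 /\ comm (act y z)) /\
    (T -> forall z, comm (act y z)).

(** Take [N_i = v_i y_i (t - v_i b v_i^-1)]: the last factor has kernel [v_i E], the functional
    [y_i] takes values in E on the vectors concerned without killing the non-zero ones on a finite
    list, and [v_i] maps E to [v_i E]. *)
Lemma ping_pong_exists (T : Prop) (S : seq (units D)) n K : functionals T ->
  exists v N, forall K', (K' <= K)%N \/ T -> ping_pong b S n v N K'.
Proof.
move=> HT; have [v [v0 vS]] := generic_vectors divD infF ncb S n.
pose Om := fix Om k := if k is k'.+1 then Om k' ++ [seq unit_val a * x | a <- S, x <- Om k']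
  else [seq v i | i <- iota 0 n].
have OmP A i : {subset A <= S} -> (i < n)%N -> forall k, (size A <= k)%N ->
    amul A (v i) \in Om k.
  elim: A => [|a A IHA] AS li k /=.
    move=> _; elim: k => [|k IHk] /=; first by apply: map_f; rewrite mem_iota.
    by rewrite mem_cat IHk.
  case: k => //= k szA; rewrite mem_cat; apply/orP; right.
  apply/allpairsP; exists (a, amul A (v i)); split => //=; first exact/AS/mem_head.
  by apply: IHA => // x xA; apply: AS; rewrite inE xA orbT.
pose g i : {poly D} := 'X - (v i * b * (v i)^-1)%:P.
(* The bound [K.+1] ensures that the vectors [a v_j] are on the list even if [K] is 0. *)
have /choice[y Hy] : forall i, exists y : {poly D},
    (forall z, z \in [seq act (g i) z | z <- Om K.+1] -> z != 0 ->
      act y z != 0 /\ comm (act y z)) /\ (T -> forall z, comm (act y z)).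
  move=> i.
  have [|y [y1 y2]] := HT [seq z <- [seq act (g i) z | z <- Om K.+1] | z != 0].
    by move=> z; rewrite mem_filter => /andP[].
  by exists y; split=> // z zi z0; apply: y1; rewrite mem_filter z0.
pose N i : {poly D} := if (i < n)%N then (v i)%:P * (y i * g i) else 0.
have NE i z : (i < n)%N -> act (N i) z = v i * act (y i) (act (g i) z).
  by move=> li; rewrite /N li actCM actM.
have gv i : (i < n)%N -> act (g i) (v i) = 0.
  move=> li; apply/eqP/(act_conj_eq0 divD); rewrite ?v0 // mulVr ?divD ?v0 //; exact: commr1.
exists v, N => K' KT; split=> //.
- by move=> i; rewrite /N ltnNge => ->.
- by move=> i li; rewrite NE // gv // actr0 mulr0.
- move=> i j a li lj aS ij; rewrite NE //; apply: div_mulf_neq0 => //; first exact: v0.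
  have [+ _] := Hy i; move=> /(_ (act (g i) (unit_val a * v j))) [] //.
    by apply: map_f; apply: (OmP [:: a]) => // x; rewrite inE => /eqP ->.
  by apply/negP => /(act_conj_eq0 divD _ _ (v0 _ li)); exact: vS.
- move=> j lj A AS szA i li; rewrite NE // mulKr ?divD ?v0 //.
  have [y1 y2] := Hy i; case: KT => [KK|/y2]; last exact.
  have [->|z0] := eqVneq (act (g i) (amul A (v j))) 0; first by rewrite actr0; exact: commr0.
  by have [] := y1 _ (map_f _ (OmP A j AS lj K.+1 (leq_trans szA (leqW KK)))) z0.
Qed.

Lemma functionals_exact (h : {poly D}) z0 : act h z0 != 0 ->
  (forall z, comm (act h z)) -> functionals True.
Proof.
move=> h0 hE Om Om0; have [y [y1 y2]] := functional_exact divD infF h0 hE Om0.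
by exists y; split=> // z zO; split=> //; exact: y1.
Qed.

Lemma functionals_finite : functionals False.
Proof.
move=> Om Om0; have [y Hy] := functional_finite divD infF b Om0.
by exists y; split.
Qed.

End Exist.

Section Contradiction.
Variable D : unitRingType.
Hypothesis divD : GRing.field_axiom D.
Local Notation word := (seq (item D)).

Definition lmulP (a : units D) (f : {poly D}) : {poly D} := (unit_val a)%:P * f.

(** A leading coefficient [C] with central coefficients acts as right multiplication by [C.[b]]. It
    kills [v l'], since [N l'] does, so it is zero; but by [chain_top] it does not kill
    [a * v l]. *)
Lemma ping_pong_not_central (b : D) (S : seq (units D)) n v (N : nat -> {poly D}) K
    l l' a (U : word) p :
  ping_pong b S n v N K -> chain l l' U -> l' <> l \/ ~ center D (unit_val a) ->
  let W := wpow (inl a :: U) p.+1 in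
  all (wf_item S n) W -> (size W < K)%N ->
  ~ forall i j, center D (sev lmulP (fun k => *%R (N k)) W (delta 1) i)`_j.
Proof.
move=> pp cU la W wfW szW cen.
have [Up [WE cUp]] : exists Up, W = inl a :: Up /\ chain l l' Up.
  rewrite /W; elim: (p) => [|q [Uq [E cUq]]]; first by exists U; rewrite /wpow /= cats0.
  exists (U ++ inl a :: Uq); split; last exact: chain_cat cU cUq la.
  by rewrite -E.
have := wfW; rewrite {1}WE /= => /andP[aS wfU].
have := szW; rewrite {1}WE /= => szU.
have [ln l'n] := chain_lt cUp wfU.
have [v0 _ Nv Nnz gv] := pp.
set i := count (@is_letter D) W.
pose C := sev lmulP (fun k => *%R (N k)) W (delta 1) i.
have CE z : good b S n v N (size W) z -> act b C z = top b N W z.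
  move=> gz; have [|||_ _ E] := top_degree divD pp (U := W) (k := 0) (d := 0) (f := delta z) wfW.
  - by rewrite addn0 ltnW.
  - by case.
  - by rewrite addn0 => -[//|j]; exact: good0.
  rewrite add0n -/i in E; rewrite -[in RHS]/(delta z 0) -E.
  have := @sev_natural D _ _ lmulP (fun k => *%R (N k)) (@lmul D) (fun k => act b (N k))
    (fun f => act b f z) (act0 b z) (fun f g => actD b f g z).
  move=> /(_ (fun a x => actCM b _ x z) (fun k x => actM b _ x z) W (delta 1)).
  rewrite delta_comp ?act0 // -[1]/(1%:P) actC mul1r => <-; by [].
have Cz z : act b C z = z * C.[b] by apply: act_central => j; exact: cen.
have topW z : top b N W z = unit_val a * top b N Up z by rewrite WE.
have szUp : (size Up <= K)%N by exact: ltnW (ltnW szU).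
have cb : C.[b] = 0.
  apply: (div_mulI divD (v0 _ l'n)); rewrite -Cz CE; last by apply: good_le (gv _ l'n); exact: ltnW.
  have [|_ [_ H]] := chain_top divD pp cUp wfU szUp (z := v l').
    by apply: good_le (gv _ l'n).
  by rewrite topW H ?Nv // !mulr0.
have g1 : good b S n v N (size W) (unit_val a * v l).
  by apply: good_mul => //; apply: good_le (gv _ ln).
have : top b N W (unit_val a * v l) = 0 by rewrite -CE // Cz cb mulr0.
rewrite topW => H.
have [|_ [H' _]] := chain_top divD pp cUp wfU szUp (z := unit_val a * v l).
  by apply: good_le g1; rewrite WE /=.
have /negP[] := Nnz _ _ _ l'n ln aS la; apply/eqP/H'.
have ua := unit_valP a; by apply: (mulrI ua); rewrite H mulr0.
Qed.

End Contradiction.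

(** * Words with central powers *)

Lemma uncountable_pigeonhole (T : Type) (F B : set T) (A : nat -> set T) :
  ~ countable F -> finite_set B -> F `<=` B `|` \bigcup_p A p ->
  exists p, infinite_set (A p).
Proof.
move=> ncF fB FBA; apply: contrapT => nA; apply: ncF.
apply: (sub_countable (subset_card_le FBA)).
rewrite -bigcup2E; apply: bigcup_countable; first by [].
move=> [|[|i]] _ /=; [exact: finite_set_countable| |exact: countable0].
apply: bigcup_countable => // p _; apply: finite_set_countable.
by apply: contrapT => iA; apply: nA; exists p.
Qed.

Section Main.
Variable D : unitRingType.
Hypothesis divD : GRing.field_axiom D.
Local Notation word := (seq (item D)).

Lemma unit_val_expg (u : units D) p : unit_val (u ^+ p)%g = unit_val u ^+ p.
Proof. by elim: p => [|p IHp]; rewrite ?expg0 ?expgS ?exprS //= IHp. Qed.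

(** A monic annihilator [g1] of least degree commutes with constants, as [d g1 - g1 d] is a shorter
    annihilator. It has the root [b], hence [g1 = h (t - b) = (t - b) h], and [(t - b) h z = 0] says
    that [h z] commutes with [b]. By minimality [h] does not annihilate [D]. *)
Lemma annihilator_functional (b : D) (g : {poly D}) : g != 0 ->
  (forall z, act b g z = 0) ->
  exists h z0, act b h z0 != 0 /\ forall z, GRing.comm b (act b h z).
Proof.
have [n] := ubnP (size g); elim: n g => // n IHn g szg g0 ag.
have lg0 : lead_coef g != 0 by rewrite lead_coef_eq0.
pose g1 := (lead_coef g)^-1%:P * g.
have c0 : (lead_coef g)^-1%:P != 0 :> {poly D} by rewrite polyC_eq0 div_invr_neq0.
have sz1 : size g1 = size g.
  by rewrite /g1 poly_size_mul // size_polyC div_invr_neq0.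
have mon1 : lead_coef g1 = 1.
  by rewrite /g1 lead_coef_proper_mul lead_coefC mulVr ?oner_neq0 ?divD.
have a1 z : act b g1 z = 0 by rewrite actCM ag mulr0.
have g10 : g1 != 0 by rewrite -lead_coef_eq0 mon1 oner_neq0.
have [cen|/existsNP[d nd]] := pselect (forall d, d%:P * g1 = g1 * d%:P); last first.
  apply: (IHn (d%:P * g1 - g1 * d%:P)); last first.
  - by move=> z; rewrite actD actN actCM actM !a1 mulr0 subr0.
  - by rewrite subr_eq0; apply/eqP.
  have p1 : (0 < size g1)%N by rewrite size_poly_gt0.
  rewrite -ltnS; apply: leq_trans szg; rewrite ltnS -sz1 -(prednK p1) ltnS.
  apply/leq_sizeP => j; rewrite coefB coefCM coefMC leq_eqVlt => /predU1P[<-|].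
    by rewrite -lead_coefE mon1 mulr1 mul1r subrr.
  by rewrite prednK // => sj; rewrite nth_default // mulr0 mul0r subr0.
have [h hE] : exists h, g1 = h * ('X - b%:P).
  by apply/factor_theorem/rootP; have := a1 1; rewrite /act polyC1 mulr1.
have h0 : h != 0 by apply: contraNneq g10 => h0; rewrite hE h0 mul0r.
have [ah|/existsNP[z0 /eqP z0h]] := pselect (forall z, act b h z = 0).
  apply: (IHn h) => //; rewrite -ltnS; apply: leq_trans szg.
  by rewrite ltnS -sz1 hE size_Mmonic ?monicXsubC // size_XsubC addn2.
exists h, z0; split=> // z.
have cX : g1 * 'X = 'X * g1 by rewrite commr_polyX.
have hE' : g1 = ('X - b%:P) * h.
  have rX : GRing.rreg ('X - b%:P : {poly D}) by apply/monic_rreg/monicXsubC.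
  by apply: rX; rewrite /= -(mulrA _ h) -hE mulrBl mulrBr cX cen.
have := a1 z; rewrite hE' actM act_XsubC => /eqP; rewrite subr_eq0 => /eqP E.
by rewrite /GRing.comm E.
Qed.

Definition coefs (U : word) : seq (units D) :=
  pmap (fun i => match i with inl a => Some a | inr _ => None end) U.

Definition letter_bound (U : word) : nat :=
  \max_(i <- U) match i with inl _ => 0 | inr l => l.1.+1 end.

Lemma wf_coefs (U : word) : all (wf_item (coefs U) (letter_bound U)) U.
Proof.
apply/allP => -[a|l] iU /=; first by rewrite mem_pmap; apply/mapP; exists (inl a).
by rewrite /letter_bound (big_rem _ iU) /= leq_maxl.
Qed.

Section Core.
Hypothesis uncF : ~ countable (center D).

Lemma infinite_center : infinite_set (center D).
Proof. by move=> /finite_set_countable. Qed.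

(** The [N k] are chosen before the exponent is known. [PP] restricts the exponents so that the
    choice suffices: either the powers are shorter than [K], or [T] gives [ping_pong] for every
    bound. *)
Lemma central_power_core (b : D) (T : Prop) (PP : nat -> Prop) K l l' a (U : word) :
  ~ center D b -> functionals b T -> chain l l' U ->
  l' <> l \/ ~ center D (unit_val a) ->
  (forall p, PP p -> (size (wpow (inl a :: U) p.+1) < K)%N \/ T) ->
  ~ forall X : nat -> units D, exists p, PP p /\
      center D (unit_val (gev X (wpow (inl a :: U) p.+1))).
Proof.
move=> ncb HT cU la HK HX; set W := inl a :: U in HK HX.
pose S := coefs W; pose n := letter_bound W.
have wfW p : all (wf_item S n) (wpow W p).
  by elim: p => // p IHp; rewrite -[wpow W p.+1]/(W ++ wpow W p) all_cat IHp andbT; exact: wf_coefs.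
have infF := infinite_center.
have [v [N pp]] := ping_pong_exists divD infF ncb S n K HT.
have N0 k : (n <= k)%N -> N k = 0 by move=> kn; have [|_ H _ _ _] := pp 0; [left|exact: H].
have fiber s : center D s -> exists p, PP p /\
    forall i, center D (sev (@lmul D) (fun k => *%R (N k).[s]) (wpow W p.+1) (delta 1) i).
  move=> cs.
  (* The [t] for which some letter [1 + t * (N k).[s]] is not invertible; there is at most one for
     each [k]. *)
  pose B := [set t | exists2 k, k \in iota 0 n & center D t /\ 1 + t * (N k).[s] = 0].
  pose A p := [set t | center D t /\ PP p /\ exists X : nat -> units D,
    (forall k, unit_val (X k) = 1 + t * (N k).[s]) /\
    center D (unit_val (gev X (wpow W p.+1)))].
  have [|t ct|p iA] := @uncountable_pigeonhole _ (center D) B A uncF.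
  - apply: finite_seq_union => k _; apply: finite_no3 => t u _ [ct Et] [cu Eu] _ tu _ _.
    have : (t - u) * (N k).[s] = 0.
      rewrite mulrBl; apply: (addrI 1); rewrite addrA Et sub0r addr0.
      by apply/eqP; rewrite eq_sym -subr_eq0 opprK Eu.
    rewrite -[RHS](mulr0 (t - u)) => /(div_mulI divD) E.
    have /eqP := Et; rewrite E ?subr_eq0; last exact/eqP.
    by rewrite mulr0 addr0 oner_eq0.
  - have [Bt|nBt] := pselect (B t); [by left|right].
    have X0 k : 1 + t * (N k).[s] != 0.
      have [kn|/N0 ->] := ltnP k n; last by rewrite horner0 mulr0 addr0 oner_neq0.
      by apply/eqP => E; apply: nBt; exists k; rewrite ?mem_iota.
    have [p [Pp cp]] := HX (fun k => Units (divD (X0 k))).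
    by exists p => //; split=> //; split=> //; exists (fun k => Units (divD (X0 k))).
  have [t [_ [Pp _]]] := infinite_setN0 iA.
  exists p; split=> //; apply: (formal_center divD iA) => t' [ct [_ HX']].
  by split.
(* Second pigeonhole, now over [s]: for one exponent the evaluated coefficients are central at
   infinitely many [s], so by [central_roots] the polynomials themselves commute with constants. *)
have [|s cs|p iA] := @uncountable_pigeonhole _ (center D) set0
    (fun p => [set s | center D s /\ (PP p /\
      forall i, center D (sev (@lmul D) (fun k => *%R (N k).[s]) (wpow W p.+1) (delta 1) i))]) uncF.
- exact: finite_set0.
- by right; have [p Hp] := fiber _ cs; exists p.
have [s0 [_ [Pp _]]] := infinite_setN0 iA.
have pp' : ping_pong b S n v N (size (wpow W p.+1)).+1 by apply: pp; exact: HK.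
apply: (ping_pong_not_central divD pp' cU la (wfW p.+1)) => [|i j d]; first exact: ltnSn.
pose C := sev (@lmulP D) (fun k => *%R (N k)) (wpow W p.+1) (delta 1) i.
suff /(congr1 (fun f : {poly D} => f`_j)) : d%:P * C = C * d%:P.
  by rewrite coefCM coefMC.
apply/eqP; rewrite -subr_eq0; apply/eqP; apply: (central_roots divD iA) => s [cs [_ Hs]].
split=> //; have hM (q r : {poly D}) : (q * r).[s] = q.[s] * r.[s].
  by apply: hornerM_comm; rewrite /comm_poly cs.
rewrite hornerD hornerN (hM d%:P C) (hM C d%:P) hornerC.
suff -> : C.[s] = sev (@lmul D) (fun k => *%R (N k).[s]) (wpow W p.+1) (delta 1) i.
  by rewrite Hs subrr.
have := @sev_natural D _ _ (@lmulP D) (fun k => *%R (N k)) (@lmul D) (fun k => *%R (N k).[s])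
    (fun f => f.[s]) (horner0 s) (fun f g => hornerD f g s).
move=> /(_ (fun a x => hornerCM _ x s) (fun k x => hM _ x) (wpow W p.+1) (delta 1)).
by rewrite delta_comp ?horner0 // -[1]/(1%:P) hornerC => <-.
Qed.

(* If some non-central b is annihilated, as an operator, by a non-zero polynomial,
   there are exact rank one operators on D and all exponents are treated at once;
   otherwise an element with a central power is central, so that the exponent is 1
   and finitely many vectors suffice. *)
Lemma no_central_power l l' a (U : word) :
  (exists b, ~ center D b) -> chain l l' U -> l' <> l \/ ~ center D (unit_val a) ->
  ~ forall X : nat -> units D, exists2 p, (0 < p)%N &
      center D (unit_val (gev X (inl a :: U)) ^+ p).
Proof.
move=> [b0 ncb0] cU la HX.
have HW X p : unit_val (gev X (wpow (inl a :: U) p)) = unit_val (gev X (inl a :: U)) ^+ p.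
  by rewrite gev_wpow unit_val_expg.
have [[b [g [ncb g0 ag]]]|nalg] := pselect (exists b (g : {poly D}),
    [/\ ~ center D b, g != 0 & forall z, act b g z = 0]).
  have [h [z0 [h0 hE]]] := annihilator_functional g0 ag.
  have fT := functionals_exact divD infinite_center h0 hE.
  apply: (@central_power_core b True (fun=> True) 0 l l' a U ncb fT cU la); first by right.
  by move=> X; have [[//|p] _ cp] := HX X; exists p; rewrite HW.
have fF := functionals_finite divD infinite_center b0.
apply: (@central_power_core b0 False (fun p => p = 0) (size (wpow (inl a :: U) 1)).+1
  l l' a U ncb0 fF cU la); first by move=> p ->; left.
move=> X; exists 0; split=> //; rewrite HW expr1; have [p p0 cp] := HX X.
move: (unit_val _) cp => x cp; apply: contrapT => ncx; apply: nalg.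
(* If [x ^+ p] is central, [t^p - x^p] sends [z] to [z x^p - x^p z = 0] in the action attached to
   [b = x]. *)
exists x, ('X^p - (x ^+ p)%:P); split => //.
  by rewrite -size_poly_eq0 size_XnsubC.
move=> z; rewrite actD actN actC.
have -> : act x 'X^p z = z * x ^+ p.
  elim: (p) => [|q IHq]; first by rewrite expr0 mulr1 -[1]/(1%:P) actC mul1r.
  by rewrite exprSr actMX IHq -mulrA -exprSr.
by rewrite cp subrr.
Qed.

End Core.
End Main.

(** * Words with values in an almost subnormal subgroup *)

Section FiniteIndex.
Local Open Scope group_scope.
Variable G : groupType.

Lemma subgroup_expg (H : set G) h n : subgroup H -> H h -> H (h ^+ n).
Proof.
move=> [H1 HM _] Hh; elim: n => [|n IHn]; first by rewrite expg0.
by rewrite expgS; apply: HM.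
Qed.

(** Two of the cosets [h^j K], [j <= size s], coincide, so some [h ^+ (j - i)] lies in [K]; the
    factorial is a multiple of every possible [j - i]. *)
Lemma finite_index_expg (K H : set G) : subgroup K -> subgroup H ->
  finite_index_in K H -> exists2 e, (0 < e)%N & forall h, H h -> K (h ^+ e).
Proof.
move=> sK sH /finite_seqP[s Es]; exists (size s)`!; first exact: fact_gt0.
move=> h Hh; pose coset j : set G := [set h ^+ j * k | k in K].
have : ~~ uniq [seq coset j | j <- iota 0 (size s).+1].
  apply/negP => us; suff : {subset [seq coset j | j <- iota 0 (size s).+1] <= s}.
    by move/(uniq_leq_size us); rewrite size_map size_iota ltnn.
  move=> _ /mapP[j _ ->].
  have : [set C : set G | exists2 h, H h & C = [set h * k | k in K]] (coset j).
    by exists (h ^+ j) => //; exact: subgroup_expg.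
  by rewrite Es.
case/(uniqPn set0) => i [j [lij]]; rewrite size_map size_iota => ljs.
have lis := ltn_trans lij ljs.
rewrite !(nth_map 0) ?size_iota // !nth_iota // !add0n => Eij.
have [K1 KM KV] := sK.
have : coset j (h ^+ j) by exists 1 => //; rewrite mulg1.
rewrite -Eij => -[k Kk Ek].
have hk : h ^+ (j - i) = k.
  by apply: (mulgI (h ^+ i)); rewrite -expgnDr Ek subnKC // ltnW.
have /dvdnP[q ->] : (j - i %| (size s)`!)%N by rewrite dvdn_fact //; lia.
by rewrite mulnC expgnA hk; exact: subgroup_expg.
Qed.

End FiniteIndex.

Section Templates.
Variable D : unitRingType.
Hypothesis divD : GRing.field_axiom D.
Local Notation word := (seq (item D)).

Lemma center_invg (a : units D) : ~ center D (unit_val a) ->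
  ~ center D (unit_val (a^-1)%g).
Proof. by move=> na /(center_inv divD) /=; rewrite invrK. Qed.

Lemma chain_inv k k' (U : word) : chain k k' U -> chain k' k (inv_word U).
Proof.
elim=> {k k' U} [k e|k k' l l' a U U' _ IHU _ IHU' ka]; first exact: chain_letter.
rewrite /inv_word map_cat rev_cat /= rev_cons cat_rcons.
apply: (chain_cat IHU' IHU); case: ka => [kl|/center_invg]; [by left => /esym|by right].
Qed.

Variable N : set (units D).

(** The words [t o] serve as values in [H] for independent letters. Their first and last indices are
    pairwise distinct, so that substituting them creates no unwanted adjacency of equal indices. *)
Definition template (H : set (units D)) := exists (t : nat -> word) (st en : nat -> nat),
  [/\ injective st, injective en, forall o o', st o <> en o',
      forall o, chain (st o) (en o) (t o) & forall X o, H (gev X (t o))].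

Lemma template_setT : template setT.
Proof.
exists (fun o => [:: inr (o.*2, false)] ++ inl 1%g :: [:: inr (o.*2.+1, false)]).
exists double, (fun o => o.*2.+1); split => //; try by move=> o o' ?; lia.
by move=> o; apply: chain_cat; [exact: chain_letter|exact: chain_letter|left; lia].
Qed.

(** The conjugate [t x t^-1] is a chain because [x] is not central, but it begins and ends with the
    same index; a product of two conjugates separates the ends. *)
Lemma template_normal (x : units D) (K H : set (units D)) :
  ~ center D (unit_val x) -> K x -> subgroup K -> subgroup H ->
  normal_in K H -> template H -> template K.
Proof.
move=> ncx Kx [_ KM _] [_ _ HV] nKH [t [st [en [sti _ se ct Ht]]]].
pose A o := t o ++ inl x :: inv_word (t o).
exists (fun o => A o.*2 ++ inl 1%g :: A o.*2.+1), (fun o => st o.*2), (fun o => st o.*2.+1).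
split=> [o o' /sti|o o' /sti|o o' /sti|o|X o]; try lia.
  have cA o' : chain (st o') (st o') (A o').
    by apply: chain_cat; [exact: ct|exact/chain_inv/ct|right].
  by apply: chain_cat; [exact: cA|exact: cA|left => /sti; lia].
have KA o' : K (gev X (A o')).
  rewrite gev_cat gev_cons gev_inv /=.
  have := nKH _ _ (HV _ (Ht X o')) Kx.
  by rewrite /conjg invgK mulgA.
by rewrite gev_cat gev_cons /= mul1g; apply: KM.
Qed.

Lemma template_finite_index (K H : set (units D)) :
  subgroup K -> subgroup H -> finite_index_in K H -> template H -> template K.
Proof.
move=> sK sH fKH [t [st [en [sti eni se ct Ht]]]].
have [[//|e] _ He] := finite_index_expg sK sH fKH.
pose P := fix P e (U : word) := if e is e'.+1 then U ++ inl 1%g :: P e' U else U.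
exists (fun o => P e (t o)), st, en; split=> // [o|X o].
  elim: (e) => [|e' IHe] //=; apply: (chain_cat (ct o) IHe); left => /esym; exact: se.
suff -> : gev X (P e (t o)) = (gev X (t o) ^+ e.+1)%g by exact: He.
elim: (e) => [|e' IHe] /=; first by rewrite expg1.
by rewrite gev_cat gev_cons /= mul1g IHe -expgS.
Qed.

(** The members of the series decrease to [H], so [x] belongs to all of them and serves at each
    normal step. *)
Lemma template_almost_subnormal (H : set (units D)) (x : units D) :
  almost_subnormal H -> H x -> ~ center D (unit_val x) -> template H.
Proof.
move=> [r [Hs [r0 H1 Hr sH Hi]]] Hx ncx.
have Hsx i : (i < r)%N -> Hs (r - i)%N x.
  elim: i => [|i IHi] lir; first by rewrite subn0 Hr.
  have [|sub _] := Hi (r - i)%N; first by lia.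
  by rewrite subnS; apply/sub/IHi/ltnW.
suff tH i : (i < r)%N -> template (Hs i.+1) by rewrite -Hr -(prednK r0); apply: tH; lia.
elim: i => [|i IHi] lir; first by rewrite H1; exact: template_setT.
have /= [|_ [nK|fK]] := Hi i.+2; first by lia.
- apply: (template_normal ncx _ _ _ nK); last by apply: IHi; lia.
  + by rewrite -[i.+2](subKn lir); apply: Hsx; lia.
  + by apply: sH; lia.
  + by apply: sH; lia.
- by apply: (template_finite_index _ _ fK); [apply: sH|apply: sH|apply: IHi]; lia.
Qed.

End Templates.

(** * Cyclic reduction of generalized monomials *)

Section Laurent.
Variables (D : unitRingType) (m : nat).
Local Notation GL := (genLaurent D m).
Implicit Types (w q : GL) (l : letter m).

Definition xlet l : GL := xpow D l.1 (if l.2 then Negz 0 else Posz 1).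

Lemma ga_eltX (F : nzRingType) (G : groupType) (g : G) k :
  ga_elt F (g ^+ k)%g = ga_elt F g ^+ k.
Proof. by elim: k => [|k IHk]; rewrite ?expg0 ?expgS ?exprS ?ga_eltM ?IHk. Qed.

Lemma xpow_letter i n : xpow D i n =
  if n is Negz k then xlet (i, true) ^+ k.+1 else xlet (i, false) ^+ absz n :> GL.
Proof.
rewrite /xlet /xpow /=; case: n => k /=; rewrite -rmorphXn -ga_eltX //.
by rewrite expVgn.
Qed.

Lemma xlet_inv l : xlet l * xlet (linv l) = 1.
Proof.
rewrite /xlet /xpow -rmorphM -ga_eltM; case: l => i [] /=;
  by rewrite ?mulVg ?mulgV ga_elt1 rmorph1.
Qed.

Lemma dconstM (a b : units D) :
  dconst m (unit_val (a * b)%g) = dconst m (unit_val a) * dconst m (unit_val b).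
Proof. exact: rmorphM. Qed.

Lemma dconst1 : dconst m (unit_val (1%g : units D)) = 1.
Proof. exact: rmorph1. Qed.

Lemma dconst_inv (a : units D) :
  dconst m (unit_val a) * dconst m (unit_val (a^-1)%g) = 1.
Proof. by rewrite -dconstM mulgV dconst1. Qed.

Lemma dconst_central (z : D) : center D z -> forall q, dconst m z * q = q * dconst m z.
Proof.
move=> cz; have zP : z \in @center_pred D by apply/centerP.
have zE : dconst m z = inrC _ _ (ga_const (freeGroup m) (CenterType zP)).
  exact: (inlC_base _ _ (CenterType zP)).
apply: coprod_ind => [a|g|p q IHp IHq|p q IHp IHq].
- rewrite /dconst -[inlC _ _ a]/(inlC _ _ a) -!(rmorphM (@inlC _ _ _ _ _)) /= cz //.
- rewrite zE -!(rmorphM (@inrC _ _ _ _ _)); congr (inrC _ _ _).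
  rewrite [LHS]ga_mulUg [RHS]ga_mulgU; apply: eq_bigr => k _.
  by rewrite mul1g mulg1 mulrC.
- by rewrite mulrDr mulrDl IHp IHq.
- by rewrite mulrA IHp -mulrA IHq mulrA.
Qed.

Implicit Type L : seq (units D * letter m).

Definition lprod L : GL := \prod_(y <- L) (dconst m (unit_val y.1) * xlet y.2).

Lemma lprod_cons y L : lprod (y :: L) = dconst m (unit_val y.1) * xlet y.2 * lprod L.
Proof. by rewrite /lprod big_cons. Qed.

Lemma lprod_cat L1 L2 : lprod (L1 ++ L2) = lprod L1 * lprod L2.
Proof. by rewrite /lprod big_cat. Qed.

Lemma lprod_absorb u L d : exists L' d', size L' = size L /\
  dconst m (unit_val u) * (lprod L * dconst m (unit_val d)) = lprod L' * dconst m (unit_val d').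
Proof.
case: L => [|[a l] L].
  by exists [::], (u * d)%g; rewrite /lprod !big_nil !mul1r dconstM.
by exists (((u * a)%g, l) :: L), d; rewrite !lprod_cons /= dconstM !mulrA.
Qed.

Lemma lprod_letters u l k L d : exists L' d',
  dconst m (unit_val u) * xlet l ^+ k * (lprod L * dconst m (unit_val d)) =
  lprod L' * dconst m (unit_val d').
Proof.
elim: k u => [|k IHk] u.
  by have [L' [d' [_ E]]] := lprod_absorb u L d; exists L', d'; rewrite expr0 mulr1.
have [L' [d' E]] := IHk 1%g; exists ((u, l) :: L'), d'.
by rewrite lprod_cons -[RHS]mulrA -E dconst1 mul1r exprS !mulrA.
Qed.

Lemma lprod_form (s : seq (units D * 'I_m * int)) (a : units D) : exists L d,
  (\prod_(y <- s) (dconst m (unit_val y.1.1) * xpow D y.1.2 y.2)) * dconst m (unit_val a) =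
  lprod L * dconst m (unit_val d).
Proof.
elim: s => [|[[u i] n] s [L [d E]]].
  by exists [::], a; rewrite /lprod !big_nil.
rewrite big_cons -mulrA E xpow_letter /=.
by case: n => k; exact: lprod_letters.
Qed.

Definition lconj w w' := exists h h' : GL, [/\ h * h' = 1, h' * h = 1 & w = h * w' * h'].

Lemma lconj_refl w : lconj w w.
Proof. by exists 1, 1; rewrite !mul1r mulr1. Qed.

Lemma lconj_trans w1 w2 w3 : lconj w1 w2 -> lconj w2 w3 -> lconj w1 w3.
Proof.
move=> [h [h' [hh hh' ->]]] [k [k' [kk kk' ->]]]; exists (h * k), (k' * h'); split.
- by rewrite mulrA -(mulrA h) kk mulr1.
- by rewrite mulrA -(mulrA k') hh' mulr1.
- by rewrite !mulrA.
Qed.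

(** The second clause is the junction of the last letter with the first one, which appears in
    powers. *)
Definition cyc_reduced y L :=
  (forall L1 L2 y1 y2, y :: L = L1 ++ y1 :: y2 :: L2 -> y2.2 = linv y1.2 ->
    ~ center D (unit_val y2.1)) /\
  (y.2 = linv (last y L).2 -> ~ center D (unit_val y.1)).

Lemma linv_neq l : l <> linv l.
Proof. by case: l => i [] []. Qed.

(** A central coefficient moves past its neighbour and lets a letter meet its inverse; at the cyclic
    junction this happens after conjugation by the letter. *)
Lemma lprod_shorten y L : ~ cyc_reduced y L -> exists L' d,
  (size L' < size (y :: L))%N /\ lconj (lprod (y :: L)) (lprod L' * dconst m (unit_val d)).
Proof.
move=> /not_andP[|].
  move=> /existsNP[L1 /existsNP[L2 /existsNP[[a1 l1] /existsNP[[a2 l2]]]]].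
  move=> /not_implyP[-> /not_implyP[/= -> /contrapT c2]].
  have [L' [d [szL E]]] := lprod_absorb (a1 * a2)%g L2 1%g.
  exists (L1 ++ L'), d; split; first by rewrite !size_cat szL /= ltn_add2l.
  suff -> : lprod (L1 ++ [:: (a1, l1), (a2, linv l1) & L2]) =
      lprod (L1 ++ L') * dconst m (unit_val d) by exact: lconj_refl.
  rewrite !lprod_cat !lprod_cons -[RHS]mulrA -E dconst1 mulr1 dconstM /= -!mulrA.
  congr (_ * (_ * _)).
  by rewrite mulrA -(dconst_central c2) -mulrA (mulrA (xlet l1)) xlet_inv mul1r.
move=> /not_implyP[/= + /contrapT cy]; case/lastP: L => [/linv_neq//|L [a l]].
rewrite last_rcons /= => yE; case: y yE cy => [u l'] /= -> cu.
have [L' [d [szL E]]] := lprod_absorb u L a.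
exists L', d; split; first by rewrite /= size_rcons szL.
exists (xlet (linv l)), (xlet l); split.
- by rewrite -{2}[l]linvK xlet_inv.
- exact: xlet_inv.
rewrite -E lprod_cons -cats1 lprod_cat lprod_cons /lprod big_nil mulr1 /=.
by rewrite (dconst_central cu) !mulrA.
Qed.

Lemma lprod_cyclic L d : (exists c, lconj (lprod L * dconst m (unit_val d)) (dconst m (unit_val c))) \/
  (exists y L', cyc_reduced y L' /\ lconj (lprod L * dconst m (unit_val d)) (lprod (y :: L'))).
Proof.
have [n] := ubnP (size L); elim: n L d => // n IHn [|y L] d szL.
  by left; exists d; rewrite /lprod big_nil mul1r; exact: lconj_refl.
pose y' := ((d * y.1)%g, y.2).
have cyy : lconj (lprod (y :: L) * dconst m (unit_val d)) (lprod (y' :: L)).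
  exists (dconst m (unit_val (d^-1)%g)), (dconst m (unit_val d)); split.
  - by rewrite -{2}[d]invgK dconst_inv.
  - exact: dconst_inv.
  by rewrite !lprod_cons -[y'.1]/(d * y.1)%g dconstM !mulrA -dconstM mulVg dconst1 mul1r.
have [red|/lprod_shorten[L' [d' [szL' cL']]]] := pselect (cyc_reduced y' L).
  by right; exists y', L.
have [|[c Hc]|[z [L2 [rz Hz]]]] := IHn L' d'.
- by rewrite -ltnS; apply: leq_trans szL; rewrite ltnS.
- by left; exists c; apply/(lconj_trans cyy)/(lconj_trans cL').
- by right; exists z, L2; split => //; apply/(lconj_trans cyy)/(lconj_trans cL').
Qed.

Lemma subst_lprod (c : 'I_m -> units D) L :
  subst c (lprod L) = unit_val (\prod_(y <- L)
    (y.1 * (if y.2.2 then (c y.2.1)^-1 else c y.2.1)))%g.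
Proof.
rewrite /lprod rmorph_prod.
elim: L => [|[a [i e]] L IHL]; first by rewrite !big_nil.
rewrite !big_cons IHL rmorphM /= subst_dconst subst_xpow.
by case: e.
Qed.

End Laurent.

Lemma conj_exp (R : pzRingType) (h h' x : R) p : h' * h = 1 -> h * h' = 1 ->
  (h * x * h') ^+ p = h * x ^+ p * h'.
Proof.
move=> hh' h'h; elim: p => [|p IHp]; first by rewrite !expr0 mulr1.
by rewrite !exprS IHp !mulrA -(mulrA (h * x)) hh' mulr1.
Qed.

Lemma center_conj (R : nzRingType) (h h' x : R) : h' * h = 1 ->
  center R (h * x * h') -> center R x.
Proof.
move=> hh' cx.
have E : x * h' = h' * (h * x * h') by rewrite !mulrA hh' mul1r.
have -> : x = h * x * h'; last exact: cx.
by rewrite -[LHS]mulr1 -hh' mulrA E -cx -mulrA hh' mulr1.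
Qed.

Lemma center_lconj_exp (D : unitRingType) (m : nat) (c : 'I_m -> units D)
    (w w' : genLaurent D m) p :
  lconj w w' -> center D (subst c w ^+ p) -> center D (subst c w' ^+ p).
Proof.
move=> [h [h' [hh h'h ->]]]; rewrite !rmorphM /=.
have fhh : subst c h * subst c h' = 1 by rewrite -rmorphM hh rmorph1.
have fh'h : subst c h' * subst c h = 1 by rewrite -rmorphM h'h rmorph1.
by rewrite conj_exp //; exact: center_conj.
Qed.

(** * Substitution of template words into a cyclically reduced monomial *)

Section Substitution.
Variables (D : unitRingType) (m : nat) (t : nat -> seq (item D)) (st en : nat -> nat).
Hypotheses (sti : injective st) (eni : injective en) (st_en : forall o o', st o <> en o').
Hypothesis ct : forall o, chain (st o) (en o) (t o).
Hypothesis divD : GRing.field_axiom D.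
Implicit Types (l : letter m) (L : seq (units D * letter m)).

Definition lword l := if l.2 then inv_word (t l.1) else t l.1.
Definition lstart l := if l.2 then en l.1 else st l.1.
Definition lend l := if l.2 then st l.1 else en l.1.

Lemma chain_lword l : chain (lstart l) (lend l) (lword l).
Proof. by case: l => i []; rewrite /lstart /lend /lword //=; exact: (chain_inv divD). Qed.

(** Indices agree at a junction only where a letter meets its inverse, which is where [cyc_reduced]
    provides a non-central coefficient. *)
Lemma lend_lstart l l' : lend l = lstart l' -> l' = linv l.
Proof.
case: l l' => i [] [j []]; rewrite /lend /lstart /linv /=.
- by move/st_en.
- by move/sti/val_inj => ->.
- by move/eni/val_inj => ->.
- by move/esym/st_en.
Qed.

Definition word_of L := flatten [seq inl y.1 :: lword y.2 | y <- L].

Lemma gev_word_of (X : nat -> units D) L : gev X (word_of L) =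
  (\prod_(y <- L) (y.1 * (if y.2.2 then (gev X (t y.2.1))^-1 else gev X (t y.2.1))))%g.
Proof.
elim: L => [|[a [i e]] L IHL]; first by rewrite /gev !big_nil.
rewrite /word_of /= gev_cons gev_cat big_cons -IHL /= mulgA; congr (_ * _ * _)%g.
by case: e => //=; rewrite gev_inv.
Qed.

Lemma chain_word_of y L :
  (forall L1 L2 y1 y2, y :: L = L1 ++ y1 :: y2 :: L2 -> y2.2 = linv y1.2 ->
    ~ center D (unit_val y2.1)) ->
  chain (lstart y.2) (lend (last y L).2) (lword y.2 ++ word_of L).
Proof.
elim: L y => [|z L IHL] y H /=; first by rewrite cats0; exact: chain_lword.
apply: chain_cat; [exact: chain_lword|apply: IHL|].
  by move=> L1 L2 y1 y2 E; apply: (H (y :: L1) L2 y1 y2); rewrite E.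
have [/lend_lstart E|ne] := pselect (lend y.2 = lstart z.2); last by left.
by right; apply: (H [::] L y z).
Qed.

End Substitution.

Theorem proposition4p1 (D : unitRingType)
    (divD : GRing.field_axiom D)
    (noncommD : exists x y : D, x * y <> y * x)
    (uncountF : ~ countable (center D))
    (N : set (units D)) (asN : almost_subnormal N)
    (m : nat) (w : genLaurent D m)
    (gpcgi_w : gpcgi N w) (nontriv_w : nontrivial_gpcgi w) :
  forall x : units D, N x -> center D (unit_val x).
Proof.
move=> x Nx; apply: contrapT => ncx.
have [[_ [s [a wE]]] wN] := gpcgi_w.
have [L [d E]] := lprod_form s a; rewrite E in wE.
have := lprod_cyclic L d; rewrite -wE.
case=> [[c wc]|[y [L' [[yL ylast] wL']]]].
  (* Here [w] is conjugate to a constant [c]. Substituting 1 for all letters makes [c ^+ p] central,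
     so its conjugate [w ^+ p] is the same constant, against non-triviality. *)
  have N1 : N 1%g.
    by case: asN => r [H [r0 _ <- sH _]]; have [|] := sH r; first by rewrite r0 leqnn.
  have [p p0] := wN (fun _ => 1%g) (fun _ => N1).
  move=> /(center_lconj_exp wc); rewrite subst_dconst => cc; apply: (nontriv_w p p0).
  have [h [h' [hh h'h ->]]] := wc; exists (unit_val c ^+ p) => //.
  rewrite conj_exp // -rmorphXn -mulrA dconst_central // mulrA hh mul1r //.
have [t [st [en [sti eni se ct Nt]]]] := template_almost_subnormal divD asN Nx ncx.
have ncb : exists b, ~ center D b.
  by case: noncommD => b [b' bb]; exists b => cb; apply: bb; exact: cb.
have cU := chain_word_of sti eni se ct divD yL.
apply: (no_central_power divD uncountF ncb cU (a := y.1)).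
  have [/(lend_lstart sti eni se)/ylast|ne] := pselect (lend st en (last y L').2 = lstart st en y.2); first by right.
  by left.
(* For arbitrary [X] the template words have values in [N], so the identity applies to them. *)
move=> X; have [|p p0 cp] := wN (fun i => gev X (t i)); first by move=> i; exact: Nt.
exists p => //; move: cp => /(center_lconj_exp wL'); rewrite subst_lprod.
by rewrite -(gev_word_of _ X) /word_of.
Qed.
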